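(* For every $c\in\mathbb{C}$ with $c\ne-\frac{22}{5}$ and every $(h,w)\in\mathbb{C}^2$, the $\mathcal{W}_3$-algebra admits a lowest weight representation with central charge $c$ and lowest weight $(h,w)$ that carries a symmetric, non-degenerate, twisted-invariant bilinear form. If, further, $c,h,w\in\mathbb{R}$, then the $\mathcal{W}_3$-algebra also admits a lowest weight representation with central charge $c$ and lowest weight $(h,w)$ that carries a non-degenerate invariant Hermitian form.
   Context: Let $V$ be a complex vector space. A formal series $\sum_{n\in\mathbb{Z}}A_n z^{-n}$ with $A_n\in\mathrm{End}(V)$ is a field on $V$ if for every $v\in V$ there is $n_v$ with $A_nv=0$ for all $n\ge n_v$. A representation of the $\mathcal{W}_3$-algebra with central charge $c\in\mathbb{C}$, $c\ne-\frac{22}{5}$, on $V$ consists of linear operators $\{L_n,W_n\}_{n\in\mathbb{Z}}$ on $V$ such that $L(z)=\sum_n L_nz^{-n-2}$ and $W(z)=\sum_n W_nz^{-n-3}$ are fields and, for all $m,n\in\mathbb{Z}$, $$[L_m,L_n]=(m-n)L_{m+n}+\tfrac{c}{12}m(m^2-1)\delta_{m+n,0},\qquad [L_m,W_n]=(2m-n)W_{m+n},$$ $$[W_m,W_n]=\tfrac{c}{3\cdot5!}(m^2-4)(m^2-1)m\,\delta_{m+n,0}+b^2(m-n)\Lambda_{m+n}+\tfrac{1}{30}(m-n)(2m^2-mn+2n^2-8)L_{m+n},$$ where $b^2=\frac{16}{22+5c}$ and $\Lambda_n=\sum_{k>-2}L_{n-k}L_k+\sum_{k\le-2}L_kL_{n-k}-\frac{3}{10}(n+2)(n+3)L_n$.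 A nonzero vector $\Psi$ is a lowest weight vector with lowest weight $(h,w)\in\mathbb{C}^2$ if $L_n\Psi=W_n\Psi=0$ for all $n>0$, $L_0\Psi=h\Psi$ and $W_0\Psi=w\Psi$. The representation is a lowest weight representation if it has a cyclic lowest weight vector (the smallest subspace containing it and invariant under all $L_n,W_n$ is $V$). A bilinear form $(\cdot,\cdot)$ on $V$ is twisted-invariant if $(L_nx,y)=(x,L_{-n}y)$ and $(W_nx,y)=(x,W_{-n}y)$ for all $x,y\in V$, $n\in\mathbb{Z}$; symmetric if $(x,y)=(y,x)$ for all $x,y$; a symmetric form is non-degenerate if $(x,y)=0$ for all $y$ implies $x=0$. A Hermitian form is a sesquilinear form with $\langle x,y\rangle=\overline{\langle y,x\rangle}$; it is invariant if $\langle L_nx,y\rangle=\langle x,L_{-n}y\rangle$ and $\langle W_nx,y\rangle=\langle x,W_{-n}y\rangle$ for all $x,y\in V$, $n\in\mathbb{Z}$, and non-degenerate if $\langle x,y\rangle=0$ for all $y$ implies $x=0$. *)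

(* Defs.v *)
From HB Require Import structures.
From mathcomp Require Import all_boot all_order all_algebra.
From mathcomp Require Import boolp classical_sets functions cardinality fsbigop.
From mathcomp Require Import reals complex.

Set Implicit Arguments.
Unset Strict Implicit.
Unset Printing Implicit Defensive.

Import Order.TTheory GRing.Theory Num.Theory.

Local Open Scope classical_set_scope.
Local Open Scope ring_scope.

Section W3.
Variables (R : realType) (V : lmodType R[i]).
Implicit Types (A L W : int -> {linear V -> V}) (c h w : R[i]) (Psi : V).

(* The formal series \sum_n A_n z^{-n} is given by its coefficients:
   A n is the coefficient of z^{-n}. *)
Definition is_field A : Prop :=
  forall v : V, exists n_v : int, forall n : int, n_v <= n -> A n v = 0.

(* A finitely supported sum has the value 0 by convention when its support is
   infinite.  This does not happen below: L_k v and L_{n-k} v vanish for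
   k -> +oo and k -> -oo respectively as soon as L is a field. *)
Definition Lambda L (n : int) (v : V) : V :=
  \sum_(k \in [set k : int | - 2 < k]) L (n - k) (L k v)
  + \sum_(k \in [set k : int | k <= - 2]) L k (L (n - k) v)
  - (3 / 10 * ((n + 2) * (n + 3))%:~R) *: L n v.

Definition b2 c : R[i] := 16 / (22 + 5 * c).

Record W3_representation c L W : Prop := {
  (* L(z) = \sum_n L_n z^{-n-2}, so the coefficient of z^{-n} is L_{n-2};
     similarly it is W_{n-3} in W(z). *)
  W3_field_L : is_field (fun n => L (n - 2));
  W3_field_W : is_field (fun n => W (n - 3));
  W3_comm_LL : forall (m n : int) (v : V),
    L m (L n v) - L n (L m v) =
      (m - n)%:~R *: L (m + n) v
      + (c / 12 * (m * (m ^+ 2 - 1))%:~R * (m + n == 0)%:R) *: v;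
  W3_comm_LW : forall (m n : int) (v : V),
    L m (W n v) - W n (L m v) = (2 * m - n)%:~R *: W (m + n) v;
  W3_comm_WW : forall (m n : int) (v : V),
    W m (W n v) - W n (W m v) =
      (c / (3 * 5`!%:R) * ((m ^+ 2 - 4) * (m ^+ 2 - 1) * m)%:~R
        * (m + n == 0)%:R) *: v
      + (b2 c * (m - n)%:~R) *: Lambda L (m + n) v
      + (1 / 30 * ((m - n) * (2 * m ^+ 2 - m * n + 2 * n ^+ 2 - 8))%:~R)
        *: L (m + n) v
}.

Definition lowest_weight_vector L W h w Psi : Prop :=
  [/\ Psi != 0,
      forall n : int, 0 < n -> L n Psi = 0 /\ W n Psi = 0,
      L 0 Psi = h *: Psi &
      W 0 Psi = w *: Psi].

Definition invariant_subspace L W (S : set V) : Prop :=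
  submod_closed [in S] /\
  forall (n : int) (v : V), S v -> S (L n v) /\ S (W n v).

Definition cyclic L W Psi : Prop :=
  smallest (invariant_subspace L W) [set Psi] = setT.

Definition lowest_weight_representation c h w L W : Prop :=
  W3_representation c L W /\
  exists Psi : V, lowest_weight_vector L W h w Psi /\ cyclic L W Psi.

(* On bilinear forms this is twisted invariance, on Hermitian forms it is
   invariance. *)
Definition invariant_form L W (f : V -> V -> R[i]) : Prop :=
  forall (n : int) (x y : V),
    f (L n x) y = f x (L (- n) y) /\ f (W n x) y = f x (W (- n) y).

Definition nondegenerate_form (f : V -> V -> R[i]) : Prop :=
  forall x : V, (forall y : V, f x y = 0) -> x = 0.

End W3.

(* Main.v *)
Require Import Defs.
From HB Require Import structures.
From mathcomp Require Import all_boot all_order all_algebra.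
From mathcomp Require Import boolp classical_sets functions cardinality fsbigop.
From mathcomp Require Import reals complex.
From mathcomp Require Import zify ring lra.

Set Implicit Arguments.
Unset Strict Implicit.
Unset Printing Implicit Defensive.

Import Order.TTheory GRing.Theory Num.Theory.

Local Open Scope ring_scope.

(** The representation is obtained by a GNS construction from a functional [phi]
    on words in the letters [L_n] and [W_n], the vacuum expectation value.

    Existence of [phi].  The commutation relations allow to straighten a word,
    i.e. to write it as a combination of words whose indices increase from left
    to right.  A sorted word containing a nonzero mode kills the lowest weight
    vector, or produces a vector that has no component along it, so [phi] must
    vanish there; on a sorted word in [L_0] and [W_0] it is a product of [h]'s
    and [w]'s.  Give weight 2 to every [L_n] and weight 3 to every [W_n].  Then
    each bracket has smaller weight than the product of its arguments, even
    [[W_m, W_n]], whose leading term is quadratic in the [L]'s; so straightening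
    terminates and defines [phi].  It satisfies all the relations, not only those
    used in the definition, by the diamond lemma: one descends on the weight and
    on the number of inversions, and the overlaps of two descents are resolved
    by the Jacobi identity ([jacobi], [exchange_overlap], [phi_exchange]).

    The Jacobi identity.  The composite modes satisfy
    [Lambda_s = sum_(k >= -1) L_(s-k) L_k + sum_(k >= s+2) L_(s-k) L_k
    - 3/10 (s+2)(s+3) L_s], and a word with a right factor of positive degree
    is killed by [phi] ([phi_vanish]); hence only finitely many terms
    contribute, and the two sums can be shifted and reindexed at will.  The
    thresholds [-1] and [s+2] are exchanged by the reflection [k -> s - k], up
    to one; commuting [L_m] or [W_m] with [Lambda_s] moves them symmetrically,
    and moving them back costs a sum of commutators, which is a polynomial in
    the indices ([tail_reflection]).  This yields [[L_m, Lambda_s]]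
    ([Lambda_L_commutator]), whose anomaly compensates the failure of the linear
    term of [[W_m, W_n]] to be covariant, precisely because
    [b^2 (22 + 5c) = 16].  It also shows that [[Lambda_s, W_k]] depends on [k] in
    such a way that the cyclic sum of [(m - n) [Lambda_(m+n), W_k]] vanishes
    ([Lambda_W_commutator], [jacobiWWW]).

    The forms.  The relations are preserved by the anti-involution [dag] that
    reverses words and negates indices, and by complex conjugation if [c], [h]
    and [w] are real.  As the relations determine [phi], it is invariant under
    both ([phi_dag], [phi_fixed]).  Represent the word [a] by the
    function [b |-> phi (b a)] on words, and let [V] be the span of these functions.
    Then [(a, b) = phi (dag b a)], extended bilinearly or sesquilinearly, is
    symmetric or Hermitian, and invariant by construction.  It is
    non-degenerate because a vector of [V] is by definition the function of
    its products with all words. *)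

(** * Sums over the integers above a threshold *)

Definition int_range (a B : int) : seq int :=
  [seq a + i%:Z | i <- iota 0 (if (a <= B)%R then `|(B - a)%R|.+1 else 0)%N].

Lemma int_range_gt a B : B < a -> int_range a B = [::].
Proof. by move=> h; rewrite /int_range leNgt h. Qed.

Lemma int_range_le a B : a <= B -> int_range a B = a :: int_range (a + 1) B.
Proof.
move=> h; rewrite /int_range h /= addr0; congr (_ :: _).
rewrite (iotaDl 1 0) -map_comp.
have -> : (if (a + 1 <= B)%R then `|(B - (a + 1))%R|.+1 else 0)%N = `|(B - a)%R|%N.
  by case: ifP; lia.
by apply: eq_map => i /=; lia.
Qed.

Section Tail.
Variable K : comNzRingType.
Implicit Types (f g p : int -> K) (a B S t : int).

Definition tail f a B : K := \sum_(k <- int_range a B) f k.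

Definition vanishes_above B f := forall k, B < k -> f k = 0.

Lemma tail_gt f a B : B < a -> tail f a B = 0.
Proof. by move=> h; rewrite /tail int_range_gt // big_nil. Qed.

Lemma tailS f a B : vanishes_above B f -> tail f a B = f a + tail f (a + 1) B.
Proof.
move=> f0; have [h|h] := leP a B; first by rewrite /tail (int_range_le h) big_cons.
by rewrite !tail_gt ?f0 ?addr0 //; lia.
Qed.

(** Sums with a fixed upper bound are handled by descending induction on the
    threshold, starting from the empty sums. *)
Lemma int_down_ind (P : int -> Prop) B :
  (forall a, B < a -> P a) -> (forall a, P (a + 1) -> P a) -> forall a, P a.
Proof.
move=> Pgt Pstep a; have [/Pgt //|h] := ltP B a.
have [n ->] : exists n : nat, a = B + 1 - n%:Z by exists `|(B + 1 - a)%R|%N; lia.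
elim: n => [|n IH]; first by apply: Pgt; lia.
by apply: Pstep; have -> : B + 1 - n.+1%:Z + 1 = B + 1 - n%:Z by lia.
Qed.

Lemma eq_tail f g a B : (forall k, k <= B -> f k = g k) -> tail f a B = tail g a B.
Proof.
move=> fg; move: a; apply: (@int_down_ind _ B) => [a h|a IH]; first by rewrite !tail_gt.
have [h|h] := leP a B; last by rewrite !tail_gt.
by rewrite /tail (int_range_le h) !big_cons fg //; congr (_ + _); exact: IH.
Qed.

Lemma tail_widen f a B B' :
  vanishes_above B f -> B <= B' -> tail f a B' = tail f a B.
Proof.
move=> f0 BB'; have f0' : vanishes_above B' f by move=> k h; apply: f0; lia.
move: a; apply: (@int_down_ind _ B') => [a h|a IH]; first by rewrite !tail_gt //; lia.
by rewrite (tailS _ f0) (tailS _ f0') IH.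
Qed.

Lemma tailD f g a B : tail (fun k => f k + g k) a B = tail f a B + tail g a B.
Proof. exact: big_split. Qed.

Lemma tailB f g a B : tail (fun k => f k - g k) a B = tail f a B - tail g a B.
Proof. exact: sumrB. Qed.

Lemma tailZ x f a B : tail (fun k => x * f k) a B = x * tail f a B.
Proof. by rewrite /tail -mulr_sumr. Qed.

Lemma tail_shift f m a B : tail (fun k => f (k + m)) a B = tail f (a + m) (B + m).
Proof.
move: a; apply: (@int_down_ind _ B) => [a h|a IH]; first by rewrite !tail_gt //; lia.
have [h|h] := leP a B; last by rewrite !tail_gt //; lia.
have h' : a + m <= B + m by lia.
rewrite /tail (int_range_le h) (int_range_le h') !big_cons; congr (_ + _).
by rewrite addrAC; exact: IH.
Qed.

Lemma tail_delta f (j : int) a B : j <= B ->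
  tail (fun k => (k == j)%:R * f k) a B = (a <= j)%R%:R * f j.
Proof.
move=> jB; move: a; apply: (@int_down_ind _ B) => [a h|a IH].
  by rewrite tail_gt // lt_geF ?mul0r //; lia.
have [h|h] := leP a B; last by rewrite tail_gt // lt_geF ?mul0r //; lia.
rewrite /tail (int_range_le h) big_cons; move: IH; rewrite /tail => ->.
have [->|aj] := eqVneq a j; first by rewrite lexx lt_geF ?mul1r ?mul0r ?addr0 //; lia.
rewrite mul0r add0r; congr (_%:R * _); congr nat_of_bool; lia.
Qed.

(** Lowering [t] to [j] by one step moves the thresholds in opposite directions;
    this adds [p j * A j] and removes [p j * A' (S - j)].  If the difference has the
    antidifference [- P], the whole expression changes by values of [P]; this
    holds in both directions, so [t] and [t'] are arbitrary.  In the applications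
    [A j] and [A' (S - j)] are two products of the same modes in opposite
    orders, and [P] is a polynomial. *)
Lemma tail_reflection (A A' p P : int -> K) S B t t' :
    vanishes_above B A -> vanishes_above B A' ->
    (forall j, p j * (A j - A' (S - j)) = P j - P (j + 1)) ->
  tail (fun k => p k * A k) t B + tail (fun k => p (S - k) * A' k) (S - t + 1) B - P t =
  tail (fun k => p k * A k) t' B + tail (fun k => p (S - k) * A' k) (S - t' + 1) B - P t'.
Proof.
move=> A0 A'0 dP.
pose D t := tail (fun k => p k * A k) t B +
  tail (fun k => p (S - k) * A' k) (S - t + 1) B - P t.
have DS j : D j = D (j + 1).
  rewrite /D (tailS j) => [|k h]; last by rewrite A0 ?mulr0.
  have -> : S - (j + 1) + 1 = S - j by lia.
  rewrite (tailS (S - j)) => [|k h]; last by rewrite A'0 ?mulr0.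
  have -> : S - (S - j) = j by lia.
  set T := tail _ _ _; set T' := tail _ _ _.
  have -> : P (j + 1) = P j - p j * (A j - A' (S - j)) by rewrite dP; ring.
  ring.
have Dn j (n : nat) : D j = D (j + n%:Z).
  elim: n => [|n IH]; first by rewrite addr0.
  by rewrite IH DS; congr D; lia.
rewrite -/(D t) -/(D t'); have [h|h] := leP t t'.
  by rewrite (Dn t `|t' - t|%N); congr D; lia.
by rewrite (Dn t' `|t - t'|%N); congr D; lia.
Qed.
End Tail.

(** * Words and brackets *)

Definition letter := (bool * int)%type.
Definition word := seq letter.
Notation Ll n := ((false, n) : letter).
Notation Wl n := ((true, n) : letter).

(** The index sum; a word of degree [n] lowers the [L_0] eigenvalue by [n]. *)
Definition deg (u : word) : int := \sum_(x <- u) x.2.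

(** These weights make [[W_m, W_n]], whose leading part is quadratic in the
    [L]'s, lighter than [W_m W_n]: 4 is less than 6. *)
Definition lwt (x : letter) : nat := if x.1 then 3 else 2.
Definition wt (u : word) : nat := \sum_(x <- u) lwt x.

Lemma deg_nil : deg [::] = 0. Proof. exact: big_nil. Qed.
Lemma deg_cons x u : deg (x :: u) = x.2 + deg u. Proof. exact: big_cons. Qed.
Lemma deg_cat u v : deg (u ++ v) = deg u + deg v. Proof. exact: big_cat. Qed.
Lemma wt_nil : wt [::] = 0%N. Proof. exact: big_nil. Qed.
Lemma wt_cons x u : wt (x :: u) = (lwt x + wt u)%N. Proof. exact: big_cons. Qed.
Lemma wt_cat u v : wt (u ++ v) = (wt u + wt v)%N. Proof. exact: big_cat. Qed.
Definition degE := (deg_cat, deg_cons, deg_nil).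
Definition wtE := (wt_cat, wt_cons, wt_nil).

Section Bracket.
Variables (K : numFieldType) (c beta : K).

Definition comb := seq (K * word).

Definition scale (a : K) (p : comb) : comb := [seq (a * q.1, q.2) | q <- p].

(** The truncation of [Lambda_s] in front of a word of degree [d].  Substituting
    [k -> s - k] in the part [k <= -2] of the normally ordered sum turns it into
    [sum_(k >= s + 2) L_(s-k) L_k], and in both parts [L_k] lowers a vector of
    degree [d] below the lowest weight as soon as [k + d > 0]. *)
Definition Lambda_comb (s d : int) : comb :=
  [seq (1, [:: Ll (s - k); Ll k]) | k <- int_range (-1) (- d) ++ int_range (s + 2) (- d)]
  ++ [:: (- (3 / 10 * ((s + 2) * (s + 3))%:~R), [:: Ll s])].

(** The empty word is present only when the indices add up to 0, so that
    every word of a bracket has the degree of the product. *)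
Definition central (a : K) (s : int) : comb :=
  if s == 0 then [:: (a, [::])] else [::].

(** The right-hand side of the commutation relation of [x] and [y], in front of
    a word of degree [d]. *)
Definition bracket (x y : letter) (d : int) : comb :=
  let: (m, n) := (x.2, y.2) in
  match x.1, y.1 with
  | false, false => central (c / 12 * (m * (m ^+ 2 - 1))%:~R) (m + n)
                    ++ [:: ((m - n)%:~R, [:: Ll (m + n)])]
  | false, true => [:: ((2 * m - n)%:~R, [:: Wl (m + n)])]
  | true, false => [:: (- (2 * n - m)%:~R, [:: Wl (m + n)])]
  | true, true =>
      central (c / (3 * 5`!%:R) * ((m ^+ 2 - 4) * (m ^+ 2 - 1) * m)%:~R) (m + n)
      ++ scale (beta * (m - n)%:~R) (Lambda_comb (m + n) d)
      ++ [:: (1 / 30 * ((m - n) * (2 * m ^+ 2 - m * n + 2 * n ^+ 2 - 8))%:~R,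
             [:: Ll (m + n)])]
  end.

Definition eval (F : word -> K) (p : comb) : K := \sum_(q <- p) q.1 * F q.2.

Lemma eval_cat F p q : eval F (p ++ q) = eval F p + eval F q.
Proof. exact: big_cat. Qed.

Lemma eval1 F a u : eval F [:: (a, u)] = a * F u.
Proof. exact: big_seq1. Qed.

Lemma eval_scale F a p : eval F (scale a p) = a * eval F p.
Proof. by rewrite /eval big_map mulr_sumr; apply: eq_bigr => q _; rewrite mulrA. Qed.

Lemma eval_central F a s : eval F (central a s) = (s == 0)%:R * (a * F [::]).
Proof.
by rewrite /central; case: eqP; rewrite ?eval1 ?mul1r // /eval big_nil mul0r.
Qed.

Lemma eval_congr F G p : (forall q, q \in p -> F q.2 = G q.2) -> eval F p = eval G p.
Proof. by move=> FG; apply: eq_big_seq => q /FG ->. Qed.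

Lemma evalB F G p : eval (fun u => F u - G u) p = eval F p - eval G p.
Proof. by rewrite /eval -sumrB; apply: eq_bigr => q _; rewrite mulrBr. Qed.

Definition LLsum (F : word -> K) (s B : int) : K :=
  tail (fun k => F [:: Ll (s - k); Ll k]) (-1) B
  + tail (fun k => F [:: Ll (s - k); Ll k]) (s + 2) B.

Lemma eval_Lambda F s d :
  eval F (Lambda_comb s d) =
  LLsum F s (- d) - 3 / 10 * ((s + 2) * (s + 3))%:~R * F [:: Ll s].
Proof.
rewrite eval_cat eval1 mulNr; congr (_ - _).
rewrite /eval big_map big_cat /=; congr (_ + _);
by rewrite /tail; apply: eq_bigr => k _; rewrite mul1r.
Qed.

Definition evalE := (eval_cat, eval1, eval_scale, eval_central, eval_Lambda).

Lemma eval_bracketLL F m n d : eval F (bracket (Ll m) (Ll n) d) =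
  (m + n == 0)%:R * (c / 12 * (m%:~R ^+ 3 - m%:~R) * F [::])
  + (m%:~R - n%:~R) * F [:: Ll (m + n)].
Proof. rewrite /bracket /= !evalE /=; ring. Qed.

Lemma eval_bracketLW F m n d : eval F (bracket (Ll m) (Wl n) d) =
  (2 * m%:~R - n%:~R) * F [:: Wl (m + n)].
Proof. rewrite /bracket /= !evalE /=; ring. Qed.

Lemma eval_bracketWL F m n d : eval F (bracket (Wl m) (Ll n) d) =
  - (2 * n%:~R - m%:~R) * F [:: Wl (m + n)].
Proof. rewrite /bracket /= !evalE /=; ring. Qed.

Lemma eval_bracketWW F m n d : eval F (bracket (Wl m) (Wl n) d) =
  (m + n == 0)%:R
    * (c / 360 * ((m%:~R ^+ 2 - 4) * (m%:~R ^+ 2 - 1) * m%:~R) * F [::])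
  + beta * (m%:~R - n%:~R) * eval F (Lambda_comb (m + n) d)
  + 1 / 30 * ((m%:~R - n%:~R)
      * (2 * m%:~R ^+ 2 - m%:~R * n%:~R + 2 * n%:~R ^+ 2 - 8)) * F [:: Ll (m + n)].
Proof.
rewrite /bracket /= eval_cat eval_central eval_cat eval_scale eval1.
have -> : 5`! = 120%N by [].
by rewrite -!addrA; congr (_ + _); [field | congr (_ + _); ring].
Qed.

Definition eval_bracketE :=
  (eval_bracketLL, eval_bracketLW, eval_bracketWL, eval_bracketWW).

(** Brackets are homogeneous and strictly decrease the weight: the first makes
    the truncations of [Lambda] consistent, the second makes straightening
    terminate. *)
Lemma bracket_grading x y d q : q \in bracket x y d ->
  (wt q.2 < lwt x + lwt y)%N /\ deg q.2 = x.2 + y.2.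
Proof.
pose ok := [pred q : K * word | (wt q.2 < lwt x + lwt y)%N && (deg q.2 == x.2 + y.2)].
suff /allP h : all ok (bracket x y d) by move=> /h /andP[? /eqP ?].
have centralP a : (0 < lwt x + lwt y)%N -> all ok (central a (x.2 + y.2)).
  rewrite /central; case: eqP => //= s0 h; rewrite !wtE !degE h /= s0 eqxx //.
rewrite {}/ok in centralP *; case: x y centralP => [[] m] [[] n] /= centralP;
  rewrite /bracket /= ?all_cat ?centralP //= ?wtE ?degE /= ?addr0 ?eqxx //.
rewrite andbT all_map all_cat /= !wtE !degE /= ?addr0 ?eqxx andbT all_map.
by rewrite (_ : all _ _) //; apply/allP => k _ /=; rewrite !wtE !degE /= addr0 subrK eqxx.
Qed.

Lemma bracket_wt x y d q : q \in bracket x y d -> (wt q.2 < lwt x + lwt y)%N.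
Proof. by case/bracket_grading. Qed.

Lemma bracket_deg x y d q : q \in bracket x y d -> deg q.2 = x.2 + y.2.
Proof. by case/bracket_grading. Qed.

(** The central coefficients are odd polynomials of [m], and only occur for
    [n = - m]. *)
Lemma bracket_anti F x y d : eval F (bracket y x d) = - eval F (bracket x y d).
Proof.
case: x y => [[] m] [[] n]; rewrite !eval_bracketE ?(addrC n m) //; try ring;
have [s0|_] := eqVneq (m + n) 0; rewrite ?mul0r; try ring;
by rewrite (_ : n = - m); [ring | lia].
Qed.

Lemma bracket_self F x d : eval F (bracket x x d) = 0.
Proof.
have /eqP := bracket_anti F x x d.
by rewrite -addr_eq0 -mulr2n mulrn_eq0 /= => /eqP.
Qed.
End Bracket.

(** * The Jacobi identity *)

Section Jacobi.
Variables (K : numFieldType) (c beta : K).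
Hypothesis beta_c : beta * (22 + 5 * c) = 16.

(** [F] stands for a functional on words restricted to words with a fixed left
    and a fixed right context, the latter of degree [d].  The relations are only
    assumed for words of weight less than [N], because the Jacobi identity is
    needed while the relations are being established by induction on the weight. *)
Definition exchange_below (F : word -> K) (d : int) (N : nat) :=
  forall p x y q, (wt (p ++ x :: y :: q) < N)%N ->
    F (p ++ x :: y :: q) =
    F (p ++ y :: x :: q) + eval (fun t => F (p ++ t ++ q)) (bracket c beta x y (deg q + d)).

Definition vanishing_below (F : word -> K) (d : int) (N : nat) :=
  forall p q, (wt (p ++ q) < N)%N -> 0 < deg q + d -> F (p ++ q) = 0.

Variables (F : word -> K) (d : int) (N : nat).
Hypotheses (exF : exchange_below F d N) (vanF : vanishing_below F d N).

Lemma exchangeLL p m n q : (wt q + wt p + 4 < N)%N ->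
  F (p ++ Ll m :: Ll n :: q) = F (p ++ Ll n :: Ll m :: q)
    + ((m + n == 0)%:R * (c / 12 * (m%:~R ^+ 3 - m%:~R) * F (p ++ q))
       + (m%:~R - n%:~R) * F (p ++ Ll (m + n) :: q)).
Proof. by move=> h; rewrite exF ?eval_bracketE // !wtE /lwt /=; lia. Qed.

Lemma exchangeLW p m n q : (wt q + wt p + 5 < N)%N ->
  F (p ++ Ll m :: Wl n :: q) = F (p ++ Wl n :: Ll m :: q)
    + (2 * m%:~R - n%:~R) * F (p ++ Wl (m + n) :: q).
Proof. by move=> h; rewrite exF ?eval_bracketE // !wtE /lwt /=; lia. Qed.

Lemma exchangeWW p m n q : (wt q + wt p + 6 < N)%N ->
  F (p ++ Wl m :: Wl n :: q) = F (p ++ Wl n :: Wl m :: q)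
    + ((m + n == 0)%:R * (c / 360 * ((m%:~R ^+ 2 - 4) * (m%:~R ^+ 2 - 1) * m%:~R) * F (p ++ q))
       + beta * (m%:~R - n%:~R) *
          eval (fun t => F (p ++ t ++ q)) (Lambda_comb K (m + n) (deg q + d))
       + 1 / 30 * ((m%:~R - n%:~R) * (2 * m%:~R ^+ 2 - m%:~R * n%:~R + 2 * n%:~R ^+ 2 - 8))
          * F (p ++ Ll (m + n) :: q)).
Proof. by move=> h; rewrite exF ?eval_bracketE // !wtE /lwt /=; lia. Qed.

(** The truncation is immaterial: all further terms vanish. *)
Lemma LLsum_widen (G : word -> K) s d' B :
  (forall i j, 0 < j + d' -> G [:: Ll i; Ll j] = 0) -> - d' <= B ->
  LLsum G s (- d') = LLsum G s B.
Proof.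
by move=> G0 h; rewrite /LLsum !(@tail_widen _ _ _ (- d') B) // => k hk; apply: G0; lia.
Qed.

(** [Lambda] is quasi-primary of weight 4, with anomaly
    [(22 + 5c)/30 (m^3 - m) L].  After commuting [L_m] through each summand, the
    sums with thresholds [-1] and [s + 2] become combinations of sums with
    thresholds [-1], [m - 1], [s + 2] and [s + m + 2]; the reflection
    [k -> s + m - k] exchanges [m - 1] and [s + 2] as well as [-1] and
    [s + m + 2], up to one. *)
Lemma Lambda_L_commutator m s : (6 < N)%N ->
  eval (fun t => F (t ++ [:: Ll m])) (Lambda_comb K s (m + d))
  - eval (fun t => F (Ll m :: t)) (Lambda_comb K s d) =
  - ((3 * m%:~R - s%:~R) * eval F (Lambda_comb K (s + m) d)
     + (22 + 5 * c) / 30 * (m%:~R ^+ 3 - m%:~R) * F [:: Ll (s + m)]).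
Proof.
move=> N6; pose S : int := s + m; rewrite -/S.
(* a common upper bound for all the sums and their translates by [m] *)
have [B hB] : exists B : int, `|d| + `|m| + `|m| + `|s| < B.
  by exists (`|d| + `|m| + `|m| + `|s| + 1); lia.
pose A k := F [:: Ll (S - k); Ll k].
have A0 : vanishes_above (- d) A.
  by move=> k h; apply: (vanF (p := [:: _]) (q := [:: _])); rewrite ?wtE ?degE /lwt /=; lia.
rewrite !eval_Lambda.
rewrite (@LLsum_widen _ s (m + d) B); first last.
- lia.
- by move=> i j h; apply: (vanF (p := [:: _]) (q := [:: _; _])); rewrite ?wtE ?degE /lwt /=; lia.
rewrite (@LLsum_widen _ s d B); first last.
- lia.
- by move=> i j h; apply: (vanF (p := [:: _; _]) (q := [:: _])); rewrite ?wtE ?degE /lwt /=; lia.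
rewrite (@LLsum_widen _ S d B); first last.
- lia.
- by move=> i j h; apply: (vanF (p := [:: _]) (q := [:: _])); rewrite ?wtE ?degE /lwt /=; lia.
have termE k : F [:: Ll (s - k); Ll k; Ll m] - F [:: Ll m; Ll (s - k); Ll k] =
   ((k + m)%:~R - 2 * m%:~R) * A (k + m) + (s%:~R - m%:~R - k%:~R) * A k
   + (k == - m)%:R * (c / 12 * (k%:~R ^+ 3 - k%:~R) * F [:: Ll (s - k)])
   + (k == S)%:R * (c / 12 * ((s - k)%:~R ^+ 3 - (s - k)%:~R) * F [:: Ll k]).
  rewrite (@exchangeLL [:: _] _ _ [::]) ?wtE // (@exchangeLL [::] (s - k) m) ?wtE //=.
  have -> : s - k + m = S - k by rewrite /S; lia.
  have -> : (k + m == 0) = (k == - m) by lia.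
  have -> : (S - k == 0) = (k == S) by lia.
  rewrite /A.
  have -> : S - (k + m) = s - k by rewrite /S; lia.
  ring.
have tailE a : tail (fun k => F [:: Ll (s - k); Ll k; Ll m]) a B
   - tail (fun k => F [:: Ll m; Ll (s - k); Ll k]) a B =
   tail (fun k => (k%:~R - 2 * m%:~R) * A k) (a + m) B
   + tail (fun k => (s%:~R - m%:~R - k%:~R) * A k) a B
   - ((a <= - m)%R%:R + (a <= S)%R%:R) * (c / 12 * (m%:~R ^+ 3 - m%:~R) * F [:: Ll S]).
  rewrite -tailB (eq_tail (g := fun k => _) a (fun k _ => termE k)) !tailD.
  rewrite !tail_delta; [|rewrite /S; lia|lia].
  rewrite (tail_shift (fun k => (k%:~R - 2 * m%:~R) * A k)).
  have -> : tail (fun k => (k%:~R - 2 * m%:~R) * A k) (a + m) (B + m)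
    = tail (fun k => (k%:~R - 2 * m%:~R) * A k) (a + m) B.
    have g0 : vanishes_above (B - `|m|) (fun k => (k%:~R - 2 * m%:~R) * A k).
      by move=> k h; rewrite A0 ?mulr0 //; lia.
    by rewrite !(tail_widen _ g0) //; lia.
  have -> : s - - m = S by rewrite /S; lia.
  have -> : s - S = - m by rewrite /S; lia.
  ring.
have {}A0 : vanishes_above B A by move=> k h; apply: A0; lia.
(* [P (j + 1) - P j] is the opposite of [p j] times the commutator of
   [L_(S-j)] and [L_j]; the second summand is its central part. *)
pose p (k : int) : K := 2 * m%:~R - k%:~R.
pose P (j' : int) : K := let j : K := j'%:~R in let S' : K := S%:~R in
  - ((2 * m%:~R * S' * j - (4 * m%:~R + S') * (j * (j - 1) / 2)
       + j * (j - 1) * (2 * j - 1) / 3) * F [:: Ll S]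
     + (S == 0)%:R * (c / 12)
       * (m%:~R * j * (j - 1) - m%:~R * (j * (j - 1)) ^+ 2 / 2
          - j * (j - 1) * (2 * j - 1) / 6
          + j * (j - 1) * (2 * j - 1) * (3 * j ^+ 2 - 3 * j - 1) / 30) * F [::]).
have dP j : p j * (A j - A (S - j)) = P j - P (j + 1).
  rewrite /A (_ : S - (S - j) = j); last by lia.
  rewrite (@exchangeLL [::] (S - j) j [::]) ?wtE //=; last by lia.
  rewrite (_ : S - j + j = S); last by lia.
  rewrite /P /p -/S; have [S0|_] := eqVneq S 0; last by rewrite !mul0r /=; field.
  by rewrite S0 /=; field.
have := tail_reflection (m - 1) (- 1) A0 A0 dP.
rewrite (_ : S - (m - 1) + 1 = s + 2); last by rewrite /S; lia.
rewrite (_ : S - -1 + 1 = S + 2); last by lia.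
pose T0 a := tail A a B; pose T1 a := tail (fun k => k%:~R * A k) a B.
have affine x y g a : (forall k, g k = x * k%:~R + y) ->
    tail (fun k => g k * A k) a B = x * T1 a + y * T0 a.
  move=> gE; rewrite -!tailZ -tailD; apply: eq_tail => k _.
  by rewrite gE mulrDl mulrA.
rewrite !(affine (-1) (2 * m%:~R) p) /p; try by move=> k; ring.
rewrite !(affine 1 (m%:~R - s%:~R)); try by move=> k; rewrite /S; ring.
move=> reflE.
have aff1 a : tail (fun k => (k%:~R - 2 * m%:~R) * A k) a B = 1 * T1 a + (- (2 * m%:~R)) * T0 a.
  by apply: affine => k; ring.
have aff2 a : tail (fun k => (s%:~R - m%:~R - k%:~R) * A k) a B =
    (-1) * T1 a + (s%:~R - m%:~R) * T0 a.
  by apply: affine => k; ring.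
rewrite /LLsum -/A.
have := tailE (-1); rewrite aff1 aff2 (_ : -1 + m = m - 1); last by lia.
have := tailE (s + 2); rewrite aff1 aff2 (_ : s + 2 + m = S + 2); last by lia.
set X1 := tail _ _ _; set Y1 := tail _ _ _; move=> e1.
set X2 := tail _ _ _; set Y2 := tail _ _ _; move=> e2.
have e3 := @exchangeLL [::] s m [::] ltac:(by rewrite ?wtE //=; lia).
(* The central terms of the single commutators contribute to each of the four
   sums only if a threshold is small enough; exactly two of them survive. *)
have boolE : ((-1 <= - m)%R%:R + (s + 2 <= - m)%R%:R + (-1 <= S)%R%:R + (s + 2 <= S)%R%:R = 2 :> K).
  have -> : (s + 2 <= S)%R = ~~ (-1 <= - m)%R by rewrite /S; lia.
  have -> : (s + 2 <= - m)%R = ~~ (-1 <= S)%R by lia.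
  by case: (-1 <= - m)%R; case: (-1 <= S)%R => /=; ring.
have e4 : ((-1 <= - m)%R%:R + (-1 <= S)%R%:R : K) = 2 - ((s + 2 <= - m)%R%:R + (s + 2 <= S)%R%:R).
  by rewrite -boolE; ring.
rewrite e4 in e2.
rewrite -/(T0 (-1)) -/(T0 (S + 2)) /= in e3 *.
have {}e3 : F [:: Ll s; Ll m] - F [:: Ll m; Ll s] =
    (S == 0)%:R * (c / 12 * (s%:~R ^+ 3 - s%:~R) * F [::]) + (s%:~R - m%:~R) * F [:: Ll S].
  by rewrite e3 -/S; ring.
set q := 3 / 10 * ((s + 2) * (s + 3))%:~R.
rewrite (_ : X2 + X1 - q * _ - _ = (X2 - Y2) + (X1 - Y1)
  - q * (F [:: Ll s; Ll m] - F [:: Ll m; Ll s])); last by ring.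
have {}reflE : T1 (m - 1) = 2 * m%:~R * T0 (m - 1) + T1 (s + 2) + (m%:~R - s%:~R) * T0 (s + 2)
   + T1 (-1) - 2 * m%:~R * T0 (-1) - T1 (S + 2) - (m%:~R - s%:~R) * T0 (S + 2)
   + (P (-1) - P (m - 1)).
  transitivity (T1 (m - 1) + ((-1 * T1 (m - 1) + 2 * m%:~R * T0 (m - 1) +
    (1 * T1 (s + 2) + (m%:~R - s%:~R) * T0 (s + 2)) - P (m - 1))
   - (-1 * T1 (-1) + 2 * m%:~R * T0 (-1) +
    (1 * T1 (S + 2) + (m%:~R - s%:~R) * T0 (S + 2)) - P (-1)))).
    by rewrite reflE; ring.
  by ring.
rewrite e2 e1 e3 {e1 e2 e3} reflE /P /q /S.
have [S0|S0] := eqVneq (s + m) 0; last by rewrite !mul0r; field.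
have -> : s = - m by lia.
by rewrite addNr; field.
Qed.

(** Once the moved thresholds are reflected back, the sums have coefficients
    that are affine in [k]; they add up to [X + k Y], where [X] and [Y] depend
    on [S = s + k] but not on [k].  This is what makes the
    cyclic sum in [jacobiWWW] vanish, since both [m - n] and [(m - n) k] have
    zero cyclic sum.  The rest is a multiple of [W_S]. *)
Lemma Lambda_W_commutator S B : exists X Y : K, forall k s : int, (7 < N)%N ->
    s + k = S -> `|d| + `|k| + `|k| + `|s| < B ->
  eval (fun t => F (t ++ [:: Wl k])) (Lambda_comb K s (k + d))
  - eval (fun t => F (Wl k :: t)) (Lambda_comb K s d) =
  X + k%:~R * Y +
  (let j : K := k%:~R - 1 in let S' : K := S%:~R in
   6 * k%:~R * S' * (j + 1) - (4 * S' + 9 * k%:~R) * (j * (j - 1) / 2 - 1)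
   + j * (j - 1) * (2 * j - 1) + 6
   - 3 / 10 * (s%:~R + 2) * (s%:~R + 3) * (2 * s%:~R - k%:~R)) * F [:: Wl S].
Proof.
pose P j := F [:: Ll (S - j); Wl j]; pose Q j := F [:: Wl (S - j); Ll j].
pose TP a := tail P a B; pose TP1 a := tail (fun j => j%:~R * P j) a B.
pose TQ a := tail Q a B; pose TQ1 a := tail (fun j => j%:~R * Q j) a B.
exists (2 * TP1 (-1) + 2 * TP1 (S + 2) - 2 * TQ1 (-1) - 2 * TQ1 (S + 2)
        + 2 * S%:~R * (TQ (-1) + TQ (S + 2))).
exists (- 3 * (TP (-1) + TP (S + 2) + TQ (-1) + TQ (S + 2))) => k s N7 sk hB.
have P0 : vanishes_above (- d) P.
  by move=> j h; apply: (vanF (p := [:: _]) (q := [:: _])); rewrite ?wtE ?degE /lwt /=; lia.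
have Q0 : vanishes_above (- d) Q.
  by move=> j h; apply: (vanF (p := [:: _]) (q := [:: _])); rewrite ?wtE ?degE /lwt /=; lia.
rewrite !eval_Lambda.
rewrite (@LLsum_widen _ s (k + d) B); first last.
- by lia.
- by move=> i j h; apply: (vanF (p := [:: _]) (q := [:: _; _])); rewrite ?wtE ?degE /lwt /=; lia.
rewrite (@LLsum_widen _ s d B); first last.
- by lia.
- by move=> i j h; apply: (vanF (p := [:: _; _]) (q := [:: _])); rewrite ?wtE ?degE /lwt /=; lia.
have termE i : F [:: Ll (s - i); Ll i; Wl k] - F [:: Wl k; Ll (s - i); Ll i] =
    (2 * (i + k)%:~R - 3 * k%:~R) * P (i + k) + (2 * S%:~R - 3 * k%:~R - 2 * i%:~R) * Q i.
  rewrite (@exchangeLW [:: _] _ _ [::]) ?wtE // (@exchangeLW [::] (s - i) k) ?wtE //=.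
  have -> : s - i + k = S - i by lia.
  have -> : s - i = S - (i + k) by lia.
  by rewrite /P /Q -sk; ring.
have affP x y g a : (forall j, g j = x * j%:~R + y) ->
    tail (fun j => g j * P j) a B = x * TP1 a + y * TP a.
  move=> gE; rewrite -!tailZ -tailD; apply: eq_tail => j _.
  by rewrite gE mulrDl mulrA.
have affQ x y g a : (forall j, g j = x * j%:~R + y) ->
    tail (fun j => g j * Q j) a B = x * TQ1 a + y * TQ a.
  move=> gE; rewrite -!tailZ -tailD; apply: eq_tail => j _.
  by rewrite gE mulrDl mulrA.
have affP1 a : tail (fun j => (2 * j%:~R - 3 * k%:~R) * P j) a B = 2 * TP1 a + (- 3 * k%:~R) * TP a.
  by apply: affP => j; ring.
have affQ1 a : tail (fun j => (2 * S%:~R - 3 * k%:~R - 2 * j%:~R) * Q j) a B =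
    (- 2) * TQ1 a + (2 * S%:~R - 3 * k%:~R) * TQ a.
  by apply: affQ => j; ring.
have tailE a : tail (fun i => F [:: Ll (s - i); Ll i; Wl k]) a B
   - tail (fun i => F [:: Wl k; Ll (s - i); Ll i]) a B =
   2 * TP1 (a + k) + (- 3 * k%:~R) * TP (a + k)
   + ((- 2) * TQ1 a + (2 * S%:~R - 3 * k%:~R) * TQ a).
  rewrite -affP1 -affQ1 -tailB (eq_tail (g := fun i => _) a (fun i _ => termE i)) tailD.
  rewrite (tail_shift (fun j => (2 * j%:~R - 3 * k%:~R) * P j)); congr (_ + _).
  have g0 : vanishes_above (- d) (fun j => (2 * j%:~R - 3 * k%:~R) * P j).
    by move=> j h; rewrite P0 ?mulr0.
  by rewrite !(tail_widen _ g0) //; lia.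
have {}P0 : vanishes_above B P by move=> j h; apply: P0; lia.
have {}Q0 : vanishes_above B Q by move=> j h; apply: Q0; lia.
pose p (j : int) : K := 2 * j%:~R - 3 * k%:~R.
(* [G (j + 1) - G j] is the opposite of [p j] times the coefficient of
   [W_S] in the commutator of [L_(S-j)] and [W_j]. *)
pose G (j' : int) : K := let j : K := j'%:~R in
  (6 * k%:~R * S%:~R * j - (4 * S%:~R + 9 * k%:~R) * (j * (j - 1) / 2)
   + j * (j - 1) * (2 * j - 1)) * F [:: Wl S].
have dG j : p j * (P j - Q (S - j)) = G j - G (j + 1).
  rewrite /P /Q (_ : S - (S - j) = j); last by lia.
  rewrite (@exchangeLW [::] (S - j) j [::]) ?wtE //=; last by lia.
  rewrite (_ : S - j + j = S); last by lia.
  by rewrite /G /p; field.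
have := tail_reflection (k - 1) (- 1) P0 Q0 dG.
rewrite (_ : S - (k - 1) + 1 = s + 2); last by lia.
rewrite (_ : S - -1 + 1 = S + 2); last by lia.
rewrite !affP1.
have affQ2 a : tail (fun j => p (S - j) * Q j) a B =
    (- 2) * TQ1 a + (2 * S%:~R - 3 * k%:~R) * TQ a.
  by apply: affQ => j; rewrite /p; ring.
rewrite !affQ2 => reflE.
rewrite /LLsum.
have := tailE (-1); rewrite (_ : -1 + k = k - 1); last by lia.
have := tailE (s + 2); rewrite (_ : s + 2 + k = S + 2); last by lia.
set X1 := tail _ _ _; set Y1 := tail _ _ _; move=> e1.
set X2 := tail _ _ _; set Y2 := tail _ _ _; move=> e2.
have e3 : F [:: Ll s; Wl k] - F [:: Wl k; Ll s] = (2 * s%:~R - k%:~R) * F [:: Wl S].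
  by rewrite (@exchangeLW [::] s k [::]) ?wtE //= ?sk; [ring | lia].
rewrite /=.
set q := 3 / 10 * ((s + 2) * (s + 3))%:~R.
rewrite (_ : X2 + X1 - q * _ - _ = (X2 - Y2) + (X1 - Y1)
  - q * (F [:: Ll s; Wl k] - F [:: Wl k; Ll s])); last by ring.
have {}reflE : 2 * TP1 (k - 1) = 3 * k%:~R * TP (k - 1)
   - (- 2 * TQ1 (s + 2) + (2 * S%:~R - 3 * k%:~R) * TQ (s + 2))
   + (2 * TP1 (-1) + (- 3 * k%:~R) * TP (-1)
      + ((- 2) * TQ1 (S + 2) + (2 * S%:~R - 3 * k%:~R) * TQ (S + 2)))
   + (G (k - 1) - G (-1)).
  transitivity (2 * TP1 (k - 1)
    - (2 * TP1 (k - 1) + - 3 * k%:~R * TP (k - 1)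
       + (- 2 * TQ1 (s + 2) + (2 * S%:~R - 3 * k%:~R) * TQ (s + 2)) - G (k - 1))
    + (2 * TP1 (-1) + - 3 * k%:~R * TP (-1)
       + (- 2 * TQ1 (S + 2) + (2 * S%:~R - 3 * k%:~R) * TQ (S + 2)) - G (-1))).
    by rewrite reflE; ring.
  by ring.
by rewrite e2 e1 e3 reflE /G /q; field.
Qed.

Definition inner_commutator x y z :=
  eval (fun t => F (t ++ [:: z])) (bracket c beta x y (z.2 + d))
  - eval (fun t => F (z :: t)) (bracket c beta x y d).

(** The sum of the [[[x, y], z]] over cyclic permutations. *)
Definition jacobiator x y z :=
  inner_commutator x y z + inner_commutator y z x + inner_commutator z x y.

Lemma jacobiLLL k m n : (6 <= N)%N -> jacobiator (Ll k) (Ll m) (Ll n) = 0.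
Proof.
move=> N6; rewrite /jacobiator /inner_commutator !eval_bracketE /=.
have comm i j : F [:: Ll i; Ll j] = F [:: Ll j; Ll i] +
   ((i + j == 0)%:R * (c / 12 * (i%:~R ^+ 3 - i%:~R) * F [::])
       + (i%:~R - j%:~R) * F [:: Ll (i + j)]).
  by rewrite (@exchangeLL [::] i j [::]) ?wtE //=; lia.
rewrite (comm _ n) (comm _ k) (comm _ m).
have -> : m + n + k = k + m + n by lia.
have -> : n + k + m = k + m + n by lia.
have [s0|_] := eqVneq (k + m + n) 0; last by rewrite !mul0r /=; ring.
by rewrite (_ : n = - k - m); [ring | lia].
Qed.

Lemma jacobiLLW k m n : (7 <= N)%N -> jacobiator (Ll k) (Ll m) (Wl n) = 0.
Proof.
move=> N6; rewrite /jacobiator /inner_commutator !eval_bracketE /=.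
have comm i j : F [:: Ll i; Wl j] = F [:: Wl j; Ll i] +
   (2 * i%:~R - j%:~R) * F [:: Wl (i + j)].
  by rewrite (@exchangeLW [::] i j [::]) ?wtE //=; lia.
rewrite !comm.
have -> : k + (m + n) = k + m + n by lia.
have -> : m + (n + k) = k + m + n by lia.
ring.
Qed.

(** The only place where the value of [b^2] matters: the anomaly of [Lambda]
    must cancel the defect of the other terms of [[W_m, W_n]]. *)
Lemma jacobiLWW k m n : (8 <= N)%N -> jacobiator (Ll k) (Wl m) (Wl n) = 0.
Proof.
move=> N8; rewrite /jacobiator /inner_commutator.
pose S := k + m + n.
have commWW i j : i + j = S -> F [:: Wl i; Wl j] - F [:: Wl j; Wl i] =
    ((S == 0)%:R * (c / 360 * ((i%:~R ^+ 2 - 4) * (i%:~R ^+ 2 - 1) * i%:~R) * F [::])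
       + beta * (i%:~R - j%:~R) * eval F (Lambda_comb K S d)
       + 1 / 30 * ((i%:~R - j%:~R) * (2 * i%:~R ^+ 2 - i%:~R * j%:~R + 2 * j%:~R ^+ 2 - 8))
          * F [:: Ll S]).
  move=> ij; rewrite (@exchangeWW [::] i j [::]) ?wtE //=; last by lia.
  rewrite ij deg_nil add0r (eval_congr (G := F)) => [|q _]; last by rewrite cats0.
  ring.
have commLL : F [:: Ll (m + n); Ll k] - F [:: Ll k; Ll (m + n)] =
   ((S == 0)%:R * (c / 12 * ((m + n)%:~R ^+ 3 - (m + n)%:~R) * F [::])
       + ((m + n)%:~R - k%:~R) * F [:: Ll S]).
  rewrite (@exchangeLL [::] (m + n) k [::]) ?wtE //=; last by lia.
  have -> : m + n + k = S by rewrite /S; lia.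
  ring.
have {}LamL := @Lambda_L_commutator k (m + n) ltac:(lia).
have eS : m + n + k = S by rewrite /S; lia.
rewrite eS in LamL.
have e1 := @commWW (k + m) n ltac:(rewrite /S; lia).
have e2 := @commWW (n + k) m ltac:(rewrite /S; lia).
rewrite !eval_bracketE /=.
set A := eval (fun t => F (t ++ [:: Ll k])) _ in LamL *.
set B := eval (fun t => F (Ll k :: t)) _ in LamL *.
pose x : K := (m - n)%:~R * (2 * m ^+ 2 - m * n + 2 * n ^+ 2 - 8)%:~R.
transitivity ((2 * k%:~R - m%:~R) * (F [:: Wl (k + m); Wl n] - F [:: Wl n; Wl (k + m)])
  + beta * (m%:~R - n%:~R) * (A - B)
  + 1 / 30 * x * (F [:: Ll (m + n); Ll k] - F [:: Ll k; Ll (m + n)])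
  - (2 * k%:~R - n%:~R) * (F [:: Wl (n + k); Wl m] - F [:: Wl m; Wl (n + k)])).
  by rewrite /x; ring.
rewrite e1 e2 LamL commLL /x.
set Z := eval F _.
have beta0 : beta != 0.
  by apply/eqP => b0; move: beta_c; rewrite b0 mul0r => /esym/eqP; rewrite pnatr_eq0.
have cE : c = (16 / beta - 22) / 5 by rewrite -beta_c; field.
rewrite cE /S.
have [s0|_] := eqVneq (k + m + n) 0; last by rewrite !mul0r /=; field.
by rewrite (_ : n = - k - m); [field | lia].
Qed.

(** The terms with [Lambda] and those with [L] cancel separately. *)
Lemma jacobiWWW k m n : (9 <= N)%N -> jacobiator (Wl k) (Wl m) (Wl n) = 0.
Proof.
move=> N9; rewrite /jacobiator /inner_commutator.
pose S := k + m + n.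
have [B hB] : exists B : int, `|d| + `|k| + `|m| + `|n| + `|k| + `|m| + `|n| < B.
  by exists (`|d| + `|k| + `|m| + `|n| + `|k| + `|m| + `|n| + 1); lia.
have [X [Y LamW]] := Lambda_W_commutator S B.
have e1 := @LamW n (k + m) ltac:(lia) ltac:(rewrite /S; lia) ltac:(lia).
have e2 := @LamW k (m + n) ltac:(lia) ltac:(rewrite /S; lia) ltac:(lia).
have e3 := @LamW m (n + k) ltac:(lia) ltac:(rewrite /S; lia) ltac:(lia).
have commLW i j : i + j = S -> F [:: Ll i; Wl j] - F [:: Wl j; Ll i] =
   (2 * i%:~R - j%:~R) * F [:: Wl S].
  by move=> ij; rewrite (@exchangeLW [::] i j [::]) ?wtE //= ?ij; [ring | lia].
have f1 := @commLW (k + m) n ltac:(rewrite /S; lia).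
have f2 := @commLW (m + n) k ltac:(rewrite /S; lia).
have f3 := @commLW (n + k) m ltac:(rewrite /S; lia).
rewrite !eval_bracketE /=.
move: e1 e2 e3.
set A1 := eval _ _; set B1 := eval _ _.
set A2 := eval _ _; set B2 := eval _ _.
set A3 := eval _ _; set B3 := eval _ _ => e1 e2 e3.
pose x (i j : int) : K := ((i - j) * (2 * i ^+ 2 - i * j + 2 * j ^+ 2 - 8))%:~R.
transitivity (
    beta * (k%:~R - m%:~R) * (A1 - B1)
  + beta * (m%:~R - n%:~R) * (A2 - B2)
  + beta * (n%:~R - k%:~R) * (A3 - B3)
  + 1 / 30 * x k m * (F [:: Ll (k + m); Wl n] - F [:: Wl n; Ll (k + m)])
  + 1 / 30 * x m n * (F [:: Ll (m + n); Wl k] - F [:: Wl k; Ll (m + n)])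
  + 1 / 30 * x n k * (F [:: Ll (n + k); Wl m] - F [:: Wl m; Ll (n + k)])).
  by rewrite /x; ring.
rewrite e1 e2 e3 f1 f2 f3 /x /S.
by field.
Qed.

Lemma jacobiator_rot x y z : jacobiator x y z = jacobiator y z x.
Proof. by rewrite /jacobiator -addrA addrC. Qed.

Lemma jacobi x y z : (lwt x + lwt y + lwt z <= N)%N -> jacobiator x y z = 0.
Proof.
case: x y z => [[] k] [[] m] [[] n]; rewrite /lwt /= => h.
- exact: jacobiWWW.
- by rewrite 2!jacobiator_rot jacobiLWW.
- by rewrite jacobiator_rot jacobiLWW.
- by rewrite jacobiator_rot jacobiLLW.
- exact: jacobiLWW.
- by rewrite 2!jacobiator_rot jacobiLLW.
- exact: jacobiLLW.
- exact: jacobiLLL.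
Qed.
End Jacobi.

(** * Straightening words *)

(** An injective key ordering the letters by index, with [L_n] before [W_n]. *)
Definition key (x : letter) : int := 2 * x.2 + (x.1 : nat)%:Z.
Definition key_le (x y : letter) : bool := key x <= key y.

Lemma key_inj : injective key.
Proof. by move=> [[] m] [[] n]; rewrite /key /= => h; congr (_, _); lia. Qed.

Lemma key_lt_index x y : key x < key y -> x.2 <= y.2.
Proof. by move: x y => [[] m] [[] n]; rewrite /key /=; lia. Qed.

Fixpoint first_descent (u : word) : option (word * letter * letter * word) :=
  if u is x :: ((y :: v) as u') then
    if key y < key x then Some ([::], x, y, v)
    else if first_descent u' is Some (p, a, b, q) then Some (x :: p, a, b, q) else None
  else None.

Lemma first_descent_cons2 x y v : first_descent (x :: y :: v) =
  if key y < key x then Some ([::], x, y, v)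
  else if first_descent (y :: v) is Some (p, a, b, q) then Some (x :: p, a, b, q) else None.
Proof. by []. Qed.

Variant first_descent_spec (u : word) : option (word * letter * letter * word) -> Type :=
| FirstDescent p a b q of u = p ++ a :: b :: q & key b < key a :
    first_descent_spec u (Some (p, a, b, q))
| NoDescent of sorted key_le u : first_descent_spec u None.

Lemma first_descentP u : first_descent_spec u (first_descent u).
Proof.
elim: u => [|x [|y u] IH]; try by constructor.
rewrite first_descent_cons2; case: ltP => [yx|xy].
  by apply: (FirstDescent (p := [::])).
case: IH => [p a b q -> ba|yu]; first exact: (FirstDescent (p := x :: p)).
by constructor; rewrite /= /key_le xy.
Qed.

(** A descent at [x, y] is the first one, or lies to the right of the first one
    and is disjoint from it, or overlaps the first one in [x]. *)
Lemma first_descent_cases u x y v : key y < key x ->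
  [\/ first_descent (u ++ x :: y :: v) = Some (u, x, y, v),
      exists u1 a b u2, [/\ u = u1 ++ a :: b :: u2, key b < key a &
         first_descent (u ++ x :: y :: v) = Some (u1, a, b, u2 ++ x :: y :: v)] |
      exists u1 a, [/\ u = rcons u1 a, key x < key a &
         first_descent (u ++ x :: y :: v) = Some (u1, a, x, y :: v)]].
Proof.
move=> yx; elim: u => [|a [|b u] IH].
- by constructor 1; rewrite /= yx.
- rewrite first_descent_cons2; case: ltP => [xa|ax]; last first.
    by constructor 1; rewrite first_descent_cons2 yx.
  by constructor 3; exists [::], a.
- rewrite !cat_cons first_descent_cons2; case: ltP => [ba|ab].
    by constructor 2; exists [::], a, b, u.
  move: IH; rewrite cat_cons.
  case=> [->|[u1 [a' [b' [u2 [-> h ->]]]]]|[u1 [a' [-> h ->]]]].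
  + by constructor 1.
  + by constructor 2; exists (a :: u1), a', b', u2.
  + by constructor 3; exists (a :: u1), a'.
Qed.

Fixpoint inversions (u : word) : nat :=
  if u is x :: u' then (count (fun y => (key y < key x)%R) u' + inversions u')%N else 0%N.

Lemma inversions_swap u x y v : key y < key x ->
  (inversions (u ++ y :: x :: v) < inversions (u ++ x :: y :: v))%N.
Proof.
move=> yx; elim: u => [|a u IH] /=; last by rewrite !count_cat /=; lia.
by rewrite yx (lt_gtF yx) /=; lia.
Qed.

Lemma inversions_le u : (inversions u <= wt u ^ 2)%N.
Proof.
elim: u => [|x u IH] //=; rewrite wtE; move: IH; rewrite -!mulnn => IH.
have : (count (fun y => (key y < key x)%R) u <= wt u)%N.
  apply: leq_trans (count_size _ _) _; elim: (u) => //= y v IHv.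
  by rewrite wtE; case: (y) => [[] ?]; rewrite /lwt /=; lia.
by case: x => [[] n]; rewrite /lwt /=; nia.
Qed.

(** The weight dominates the number of inversions, which is at most the square
    of the weight; hence a single natural number decreases both when a descent
    is exchanged and when it is replaced by its bracket. *)
Definition rank (u : word) : nat := (wt u ^ 3 + inversions u)%N.

Lemma rank_wt u v : (wt u < wt v)%N -> (rank u < rank v)%N.
Proof.
move=> uv; rewrite /rank; have := inversions_le u.
have : ((wt u).+1 ^ 3 <= wt v ^ 3)%N by rewrite leq_exp2r.
by rewrite !(expnS (wt u)) !(expnS (wt u).+1) !expn0 !muln1; nia.
Qed.

Lemma rank_swap u x y v : key y < key x -> (rank (u ++ y :: x :: v) < rank (u ++ x :: y :: v))%N.
Proof. by move=> /(inversions_swap u v); rewrite /rank !wtE /=; rewrite (addnCA (lwt y)) ltn_add2l. Qed.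

Section State.
Variables (K : numFieldType) (c h w beta : K).
Hypothesis beta_c : beta * (22 + 5 * c) = 16.

(** The eigenvalue of a zero mode on the lowest weight vector.  The value 0 on
    the other modes makes the product over a sorted word vanish unless all its
    letters are zero modes. *)
Definition weight_of (x : letter) : K := if x.2 == 0 then (if x.1 then w else h) else 0.

(** Straightening, with the number of remaining steps as fuel. *)
Fixpoint phi_rec (n : nat) (u : word) : K :=
  if n is n'.+1 then
    if first_descent u is Some (p, x, y, q) then
      phi_rec n' (p ++ y :: x :: q)
      + eval (fun t => phi_rec n' (p ++ t ++ q)) (bracket c beta x y (deg q))
    else \prod_(x <- u) weight_of x
  else 0.

Definition phi (u : word) : K := phi_rec (rank u).+1 u.

Lemma wt_bracket (p : word) x y (q : word) d (t : K * word) : t \in bracket c beta x y d ->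
  (wt (p ++ t.2 ++ q) < wt (p ++ x :: y :: q))%N.
Proof. by move=> /bracket_wt lt_t; rewrite !wtE ltn_add2l addnA ltn_add2r. Qed.

Lemma phi_rec_stable n m u : (rank u < n)%N -> (rank u < m)%N -> phi_rec n u = phi_rec m u.
Proof.
elim: n m u => // n IH [//|m] u hn hm /=.
case: first_descentP hn hm => // p x y q -> yx hn hm.
have r := rank_swap p q yx; congr (_ + _).
  by apply: IH; [exact: leq_trans r hn | exact: leq_trans r hm].
apply: eval_congr => t tin; have /rank_wt rt := wt_bracket p q tin.
by apply: IH; [exact: leq_trans rt hn | exact: leq_trans rt hm].
Qed.

Lemma phi_sorted u : sorted key_le u -> phi u = \prod_(x <- u) weight_of x.
Proof.
rewrite /phi /=; case: first_descentP => // p x y q -> yx /cat_sorted2[_] /=.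
by rewrite /key_le leNgt yx.
Qed.

Lemma phi_descent u p x y q : first_descent u = Some (p, x, y, q) ->
  phi u = phi (p ++ y :: x :: q)
          + eval (fun t => phi (p ++ t ++ q)) (bracket c beta x y (deg q)).
Proof.
move=> E; rewrite {1}/phi /= E.
case: first_descentP E => // p' x' y' q' uE yx [? ? ? ?]; subst p' x' y' q'.
have r := rank_swap p q yx; rewrite -uE in r.
congr (_ + _); first exact: phi_rec_stable.
apply: eval_congr => t tin; have /rank_wt rt := wt_bracket p q tin.
by apply: phi_rec_stable; rewrite // uE.
Qed.

Lemma weight_of_prod0 u v : deg v <> 0 -> \prod_(x <- u ++ v) weight_of x = 0.
Proof.
move=> dv; rewrite big_cat /= [X in _ * X](_ : _ = 0) ?mulr0 //.
elim: v dv => [|y v IH]; first by rewrite deg_nil.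
rewrite degE big_cons; have [y0|y0] := eqVneq y.2 0.
  by rewrite y0 add0r => /IH ->; rewrite mulr0.
by rewrite /weight_of (negbTE y0) mul0r.
Qed.

Definition exchange_at (u : word) x y (v : word) :=
  phi (u ++ x :: y :: v) =
  phi (u ++ y :: x :: v) + eval (fun t => phi (u ++ t ++ v)) (bracket c beta x y (deg v)).

Lemma exchange_at_sym u x y v : exchange_at u x y v -> exchange_at u y x v.
Proof. by rewrite /exchange_at => ->; rewrite (bracket_anti _ _ _ x y) addrK. Qed.

(** The relations are antisymmetric in the two letters, so it suffices to treat
    descents. *)
Lemma exchange_at_sorted u x y v :
  (key y < key x -> exchange_at u x y v) -> (key x < key y -> exchange_at u y x v) ->
  exchange_at u x y v.
Proof.
case: (ltgtP (key x) (key y)) => [_ _ /(_ isT) /exchange_at_sym //|_ /(_ isT) //|].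
by move=> /key_inj -> _ _; rewrite /exchange_at bracket_self addr0.
Qed.

Definition exchange_upto n := forall u x y v, (wt (u ++ x :: y :: v) < n)%N -> exchange_at u x y v.
Definition vanishing_upto n := forall u v, (wt (u ++ v) < n)%N -> 0 < deg v -> phi (u ++ v) = 0.

(** Fixing the contexts [u] and [v] turns the relations for [phi] into the
    hypotheses of the Jacobi identity. *)
Lemma exchange_in_context n u v m : exchange_upto n -> (m + wt u + wt v <= n)%N ->
  exchange_below c beta (fun t => phi (u ++ t ++ v)) (deg v) m.
Proof.
move=> ex hm p x y q pq; have := ex (u ++ p) x y (q ++ v).
rewrite /exchange_at -!catA !cat_cons !degE => ->; last by move: pq; rewrite !wtE /=; lia.
by congr (_ + _); apply: eval_congr => t _; rewrite -!catA.
Qed.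

Lemma vanishing_in_context n u v m : vanishing_upto n -> (m + wt u + wt v <= n)%N ->
  vanishing_below (fun t => phi (u ++ t ++ v)) (deg v) m.
Proof.
move=> van hm p q pq qv; have := van (u ++ p) (q ++ v).
by rewrite -!catA degE => -> //; move: pq; rewrite !wtE /=; lia.
Qed.

Lemma eval_exchange (G : word -> word -> K) p q :
  eval (fun s => eval (G s) q) p = eval (fun t => eval (G^~ t) p) q.
Proof.
rewrite /eval; under eq_bigr do rewrite mulr_sumr.
rewrite exchange_big; apply: eq_bigr => t _; rewrite mulr_sumr.
by apply: eq_bigr => s _; rewrite mulrCA.
Qed.

Section Step.
Variable n : nat.
Hypotheses (ex_n : exchange_upto n) (van_n : vanishing_upto n).

(** The word is straightened at [x, y], while the relation is claimed at
    [y, z].  The four other relations bring both sides to the order [z, y, x],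
    and the six brackets that appear on the way cancel by the Jacobi identity,
    which only involves lighter words. *)
Lemma exchange_overlap u x y z v : wt (u ++ x :: y :: z :: v) = n ->
    first_descent (u ++ x :: y :: z :: v) = Some (u, x, y, z :: v) ->
    exchange_at (rcons u y) x z v -> exchange_at u y z (x :: v) ->
    exchange_at u x z (y :: v) -> exchange_at (rcons u z) x y v ->
  exchange_at (rcons u x) y z v.
Proof.
move=> wtn fd; rewrite /exchange_at !cat_rcons (phi_descent fd) => -> -> -> ->.
have wtE' : (lwt x + lwt y + lwt z + wt u + wt v = n)%N by rewrite -wtn !wtE; lia.
have /(_ x y z (leqnn _)) := @jacobi K c beta beta_c (fun t => phi (u ++ t ++ v)) (deg v) _
  (exchange_in_context ex_n (eq_leq wtE')) (vanishing_in_context van_n (eq_leq wtE')).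
rewrite /jacobiator /inner_commutator !degE.
rewrite !(bracket_anti _ _ _ x z).
have ctxr a p : eval (fun t => phi (u ++ (t ++ [:: a]) ++ v)) p =
    eval (fun t => phi (u ++ t ++ a :: v)) p.
  by apply: eval_congr => t _; rewrite -catA.
have ctxl a p : eval (fun t => phi (u ++ (a :: t) ++ v)) p =
    eval (fun t => phi (rcons u a ++ t ++ v)) p.
  by apply: eval_congr => t _; rewrite cat_rcons.
rewrite !ctxr !ctxl => J; apply: subr0_eq; rewrite -[RHS]J; ring.
Qed.

(** Two disjoint descents can be exchanged in either order: the difference is
    the same double sum over the two brackets, because these do not change the
    degree and hence not the truncations. *)
Lemma exchange_disjoint u1 a b u2 x y v :
    let u := u1 ++ a :: b :: u2 in
    wt (u ++ x :: y :: v) = n ->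
    first_descent (u ++ x :: y :: v) = Some (u1, a, b, u2 ++ x :: y :: v) ->
    exchange_at (u1 ++ b :: a :: u2) x y v -> exchange_at u1 a b (u2 ++ y :: x :: v) ->
  exchange_at u x y v.
Proof.
move=> u wtn fd; rewrite /exchange_at (phi_descent fd) /u -!catA !cat_cons => -> ->.
have degE' : deg (u2 ++ y :: x :: v) = deg (u2 ++ x :: y :: v) by rewrite !degE; lia.
rewrite degE'; set bab := bracket _ _ a b _; set bxy := bracket _ _ x y _.
pose G p q := phi (u1 ++ p ++ u2 ++ q ++ v).
have swap_xy : eval (fun t => phi (u1 ++ t ++ u2 ++ x :: y :: v)) bab
    - eval (fun t => phi (u1 ++ t ++ u2 ++ y :: x :: v)) bab = eval (fun p => eval (G p) bxy) bab.
  rewrite -evalB; apply: eval_congr => p pin.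
  have := @ex_n (u1 ++ p.2 ++ u2) x y v; rewrite /exchange_at -!catA => ->; last first.
    by rewrite -wtn /u -!catA; exact: wt_bracket pin.
  by rewrite addrC addKr; apply: eval_congr => q _; rewrite -!catA.
have swap_ab : eval (fun t => phi ((u1 ++ a :: b :: u2) ++ t ++ v)) bxy
    - eval (fun t => phi ((u1 ++ b :: a :: u2) ++ t ++ v)) bxy = eval (fun q => eval (G^~ q) bab) bxy.
  rewrite -evalB; apply: eval_congr => q qin.
  have := @ex_n u1 a b (u2 ++ q.2 ++ v); rewrite /exchange_at -!catA !cat_cons => ->; last first.
    have := wt_bracket (u1 ++ a :: b :: u2) v qin.
    by rewrite wtn -!catA !cat_cons.
  rewrite addrC addKr /bab; congr (eval _ (bracket _ _ _ _ _)).
  by rewrite !degE (bracket_deg qin); lia.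
apply: subr0_eq; move: swap_ab; rewrite -eval_exchange -swap_xy => /eqP.
by rewrite -subr_eq0 => /eqP J; rewrite -[RHS]oppr0 -J; ring.
Qed.

(** Induction on the number of inversions, for words of weight [n]: the
    relation at a given descent is compared with the one at the first descent,
    which holds by definition of [phi]. *)
Lemma exchange_step u x y v : wt (u ++ x :: y :: v) = n -> exchange_at u x y v.
Proof.
suff desc : forall i u x y v, (inversions (u ++ x :: y :: v) < i)%N -> wt (u ++ x :: y :: v) = n ->
    key y < key x -> exchange_at u x y v.
  move=> wtn; apply: exchange_at_sorted => yx; apply: (desc _ _ _ _ _ (leqnn _) _ yx) => //.
  by rewrite -wtn !wtE; lia.
elim=> // i IH {}u {}x {}y {}v; rewrite ltnS => inv_i wtn yx.
have [fd|[u1 [a [b [u2 [uE ba fd]]]]]|[u1 [a [uE xa fd]]]] := first_descent_cases u v yx.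
- exact: phi_descent.
- rewrite {u}uE in inv_i wtn fd *; apply: exchange_disjoint => //.
  + apply: IH => //; last by rewrite -wtn !wtE; lia.
    apply: leq_trans inv_i; rewrite -!catA !cat_cons; exact: inversions_swap.
  + apply: IH => //; last by rewrite -wtn !wtE; lia.
    apply: leq_trans inv_i; have := inversions_swap (u1 ++ a :: b :: u2) v yx.
    by rewrite -!catA !cat_cons.
- rewrite {u}uE in inv_i wtn fd *; rewrite !cat_rcons in inv_i wtn fd.
  have ya : key y < key a := lt_trans yx xa.
  have i1 := inversions_swap u1 (y :: v) xa.
  have i2 := inversions_swap (rcons u1 x) v ya; rewrite !cat_rcons in i2.
  have i3 := inversions_swap (rcons u1 a) v yx; rewrite !cat_rcons in i3.
  have i4 := inversions_swap u1 (x :: v) ya.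
  apply: exchange_overlap => //; apply: IH; rewrite ?cat_rcons //;
    try (by rewrite -wtn !wtE; lia).
  + exact: leq_trans i1 inv_i.
  + exact: leq_trans (ltn_trans i2 i1) inv_i.
  + exact: leq_trans i3 inv_i.
  + exact: leq_trans (ltn_trans i4 i3) inv_i.
Qed.

(** A sorted word with a factor of nonzero degree has a nonzero mode.
    Otherwise one exchanges a descent; if it lies on the border of the two
    factors [u x] and [y v], then [x v] still has positive degree because the
    index of [x] is at least that of [y], and the bracket is attached to [v] if
    [v] has nonpositive degree. *)
Lemma vanishing_step u v : wt (u ++ v) = n -> 0 < deg v -> phi (u ++ v) = 0.
Proof.
have [b] := ubnP (inversions (u ++ v)); elim: b u v => // b IH u v; rewrite ltnS => inv_i wtn v0.
have straighten p x y q : u ++ v = p ++ x :: y :: q -> key y < key x ->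
    (exists u' v', [/\ p ++ y :: x :: q = u' ++ v' & 0 < deg v']) ->
    (forall t, (wt (p ++ t ++ q) < n)%N -> deg t = x.2 + y.2 -> phi (p ++ t ++ q) = 0) ->
    phi (u ++ v) = 0.
  move=> uvE yx [u' [v' [swapE v'0]]] low; rewrite uvE in inv_i wtn *.
  rewrite exchange_step // swapE IH ?add0r //.
  - rewrite /eval big_seq big1 // => t tin.
    by rewrite low ?mulr0 ?(bracket_deg tin) // -wtn (wt_bracket _ _ tin).
  - by rewrite -swapE; apply: leq_trans inv_i; exact: inversions_swap.
  - by rewrite -swapE -wtn !wtE; lia.
case: (first_descentP v) => [p x y q vE yx|v_sorted].
  apply: (@straighten (u ++ p) x y q) => //; first by rewrite vE catA.
    by exists u, (p ++ y :: x :: q); rewrite catA; split=> //; move: v0; rewrite vE !degE; lia.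
  move=> t wtt degt; rewrite -catA; apply: van_n; first by rewrite catA.
  by move: v0; rewrite vE !degE degt; lia.
case: (first_descentP u) => [p x y q uE yx|u_sorted].
  apply: (@straighten p x y (q ++ v)) => //; first by rewrite uE -catA.
    by exists (p ++ y :: x :: q), v; rewrite -catA.
  by move=> t wtt degt; rewrite !catA; apply: van_n => //; rewrite -!catA.
case: v v0 v_sorted inv_i wtn straighten => [|y v] v0 v_sorted inv_i wtn straighten.
  by rewrite deg_nil in v0.
case/lastP: u u_sorted inv_i wtn straighten => [|u x] u_sorted inv_i wtn straighten.
  by rewrite phi_sorted ?weight_of_prod0 //; lia.
have [xy|yx] := leP (key x) (key y).
  rewrite phi_sorted ?weight_of_prod0 //; first by lia.
  case: u u_sorted {inv_i wtn straighten} => [|a u] /=; first by rewrite /key_le xy.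
  by rewrite cat_path last_rcons /= => ->; rewrite /key_le xy.
apply: (straighten u x y v); rewrite ?cat_rcons //.
  exists (rcons u y), (x :: v); rewrite cat_rcons; split=> //.
  by move: v0 (key_lt_index yx); rewrite !degE; lia.
move=> t wtt degt; have [v'0|v'0] := ltP 0 (deg v).
  by rewrite catA; apply: van_n; rewrite // -catA.
apply: van_n => //; rewrite degE degt.
by move: v0 (key_lt_index yx); rewrite !degE; lia.
Qed.
End Step.

Lemma exchange_and_vanishing n : exchange_upto n /\ vanishing_upto n.
Proof.
elim: n => [|n [ex_n van_n]]; first by split=> ? ?.
split=> [u x y v|u v]; rewrite ltnS leq_eqVlt => /orP[/eqP wtn|wtn].
- exact: exchange_step wtn.
- exact: ex_n.
- exact: vanishing_step wtn.
- exact: van_n.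
Qed.

Lemma phi_exchange u x y v : phi (u ++ x :: y :: v) =
  phi (u ++ y :: x :: v) + eval (fun t => phi (u ++ t ++ v)) (bracket c beta x y (deg v)).
Proof. by have [ex _] := exchange_and_vanishing (wt (u ++ x :: y :: v)).+1; exact: ex. Qed.

Lemma phi_vanish u v : 0 < deg v -> phi (u ++ v) = 0.
Proof. by have [_ van] := exchange_and_vanishing (wt (u ++ v)).+1; exact: van. Qed.

(** The induction principle behind straightening. *)
Lemma word_ind (P : word -> Prop) :
  (forall u, sorted key_le u -> P u) ->
  (forall p x y q, key y < key x -> P (p ++ y :: x :: q) ->
     (forall t d, t \in bracket c beta x y d -> P (p ++ t.2 ++ q)) -> P (p ++ x :: y :: q)) ->
  forall u, P u.
Proof.
move=> Psorted Pstep u; have [b] := ubnP (rank u); elim: b u => // b IH u; rewrite ltnS => ui.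
case: (first_descentP u) ui => [p x y q -> yx ui|/Psorted //].
apply: Pstep => // [|t d tin]; apply: IH; apply: leq_trans ui; first exact: rank_swap.
exact/rank_wt/(wt_bracket _ _ tin).
Qed.

Lemma phi_nil : phi [::] = 1.
Proof. by rewrite phi_sorted // big_nil. Qed.

Lemma phi_deg u : deg u <> 0 -> phi u = 0.
Proof.
elim/word_ind: u => [u u_sorted du|p x y q yx IHswap IHbr].
  by rewrite phi_sorted // (weight_of_prod0 [::]).
rewrite !degE => du; rewrite phi_exchange IHswap ?add0r; last by rewrite !degE; lia.
rewrite /eval big_seq big1 // => t tin.
by rewrite (IHbr _ _ tin) ?mulr0 // !degE (bracket_deg tin); lia.
Qed.

(** Either the right factor has positive degree, or the whole word has negative
    degree. *)
Lemma phi_vanish_left u v : deg u < 0 -> phi (u ++ v) = 0.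
Proof.
move=> du; have [v0|v0] := ltP 0 (deg v); first exact: phi_vanish.
by apply: phi_deg; rewrite degE; lia.
Qed.

Definition zero_mode (x : letter) := x.2 == 0.

Lemma phi_zero_modes u : all zero_mode u -> phi u = \prod_(x <- u) weight_of x.
Proof.
elim/word_ind: u => [u u_sorted _|p x y q yx IHswap _ zeros]; first exact: phi_sorted.
have [zx zy] : x.2 = 0 /\ y.2 = 0.
  by move: zeros; rewrite all_cat /= => /and4P[_ /eqP ? /eqP ?].
rewrite phi_exchange IHswap; last by move: zeros; rewrite !all_cat /= (andbCA (zero_mode y)).
rewrite !big_cat !big_cons /= [X in _ + X](_ : _ = 0) ?addr0; first by rewrite (mulrCA (weight_of x)).
case: x y zx zy yx {IHswap zeros} => [[] m] [[] m'] /= -> -> yx; rewrite eval_bracketE //; ring.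
Qed.

Lemma deg_ge0 u : all (fun a : letter => 0 <= a.2) u -> 0 <= deg u.
Proof. by elim: u => [|a u IH] /=; rewrite ?deg_nil // degE => /andP[? /IH]; lia. Qed.

Lemma deg_le0 u : all (fun a : letter => a.2 <= 0) u -> deg u <= 0.
Proof. by elim: u => [|a u IH] /=; rewrite ?deg_nil // degE => /andP[? /IH]; lia. Qed.

Lemma key_le_trans : transitive key_le.
Proof. by move=> y x z; rewrite /key_le; exact: le_trans. Qed.

(** The nonzero modes of a sorted word are positive modes on its right end or
    negative modes on its left end. *)
Lemma sorted_nonzero_mode u : sorted key_le u -> ~~ all zero_mode u ->
  exists p q, u = p ++ q /\ (0 < deg q \/ deg p < 0).
Proof.
move=> u_sorted /allPn[y yu zy].
have [/hasP[a au a0]|/hasPn u_le0] := boolP (has (fun a : letter => 0 < a.2) u).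
  case: (splitPr au) u_sorted => p q /cat_sorted2[_ aq].
  exists p, (a :: q); split=> //; left.
  have q0 : 0 <= deg q.
    apply: deg_ge0; apply/allP => b bq.
    have /allP/(_ b bq) := order_path_min key_le_trans aq.
    by rewrite /key_le /key; case: (a) a0 (b) => [[] m] /= m0 [[] m'] /=; lia.
  by rewrite degE; lia.
case: (splitPr yu) u_le0 => p q u_le0; exists (rcons p y), q; rewrite cat_rcons; split=> //; right.
have y0 : y.2 < 0.
  have := u_le0 y; rewrite mem_cat inE eqxx orbT => /(_ isT) /=.
  by move: zy; rewrite /zero_mode; case: ltgtP.
have p0 : deg p <= 0.
  by apply: deg_le0; apply/allP => b bp; rewrite leNgt u_le0 // mem_cat bp.
rewrite -cats1 !degE addr0; exact: (ler_ltD p0 y0).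
Qed.

(** On a word of zero modes this is the definition of [phi], on the other
    sorted words both sides vanish, and straightening the left factor commutes
    with appending a zero mode since this does not change degrees. *)
Lemma phi_eigen u x : zero_mode x -> phi (rcons u x) = weight_of x * phi u.
Proof.
move=> zx; elim/word_ind: u => [u u_sorted|p a b q ba IHswap IHbr].
  have [zu|/(sorted_nonzero_mode u_sorted)[p [q [-> pq]]]] := boolP (all zero_mode u).
    rewrite !phi_zero_modes ?all_rcons ?zx //.
    by rewrite -cats1 big_cat /= big_seq1 mulrC.
  rewrite rcons_cat; case: pq => [q0|p0]; last by rewrite !phi_vanish_left ?mulr0.
  by rewrite !phi_vanish ?mulr0 // -cats1 !degE (eqP zx) !addr0.
rewrite rcons_cat !rcons_cons phi_exchange -rcons_cons -rcons_cons -rcons_cat IHswap.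
rewrite (phi_exchange p a) mulrDr; congr (_ + _).
rewrite -cats1 degE !degE (eqP zx) !addr0 /eval mulr_sumr big_seq [RHS]big_seq.
apply: eq_bigr => t tin; rewrite mulrCA -(IHbr _ _ tin).
by rewrite cats1 !rcons_cat.
Qed.

(** The anti-involution exchanging [L_n] with [L_(-n)] and [W_n] with [W_(-n)]. *)
Definition adj (x : letter) : letter := (x.1, - x.2).
Definition dag (u : word) : word := rev (map adj u).

Lemma dag_cat u v : dag (u ++ v) = dag v ++ dag u.
Proof. by rewrite /dag map_cat rev_cat. Qed.

Lemma dag_cons x u : dag (x :: u) = rcons (dag u) (adj x).
Proof. by rewrite /dag /= rev_cons. Qed.

Lemma dagK : involutive dag.
Proof.
move=> u; rewrite /dag map_rev revK -map_comp -[RHS]map_id.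
by apply: eq_map => -[b n]; rewrite /adj /= opprK.
Qed.

Lemma deg_dag u : deg (dag u) = - deg u.
Proof.
by elim: u => [|x u IH]; rewrite ?deg_nil // dag_cons -cats1 !degE IH addr0 opprD addrC.
Qed.

(** The adjoint reverses the products [L_(s-k) L_k], so it permutes the two
    half-line sums up to a translation of the thresholds from [-1] to [2].
    The three commutators that result add up to [3 s L_(-s)], which is the
    difference of the linear correction terms of [Lambda_s] and [Lambda_(-s)]. *)
Lemma Lambda_dag p q s :
  eval (fun t => phi (dag q ++ t ++ dag p)) (Lambda_comb K (- s) (- deg p)) =
  eval (fun t => phi (dag q ++ dag t ++ dag p)) (Lambda_comb K s (deg q)).
Proof.
set F := fun t => phi (dag q ++ t ++ dag p).
have [B hB] : exists B : int, `|deg p| + `|deg q| + `|s| < B.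
  by exists (`|deg p| + `|deg q| + `|s| + 1); lia.
have exF : exchange_below c beta F (- deg p) (6 + wt (dag q) + wt (dag p)).
  have [ex _] := exchange_and_vanishing (6 + wt (dag q) + wt (dag p) + wt (dag q) + wt (dag p)).
  rewrite -deg_dag; exact: exchange_in_context ex (leqnn _).
pose f k := F [:: Ll (- s - k); Ll k].
have f0 : vanishes_above (deg p) f.
  move=> k kp; have := @phi_vanish (dag q ++ [:: Ll (- s - k)]) (Ll k :: dag p).
  by rewrite -catA degE deg_dag; apply => /=; lia.
rewrite !eval_Lambda (@LLsum_widen K F (- s) (- deg p) B); first last.
- by lia.
- move=> i j ij; have := @phi_vanish (dag q ++ [:: Ll i]) (Ll j :: dag p).
  by rewrite -catA degE deg_dag; apply => /=; lia.
rewrite (@LLsum_widen K (F \o dag) s (deg q) B); first last.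
- by lia.
- move=> i j ij /=; have := @phi_vanish_left (dag q ++ [:: Ll (- j)]) (Ll (- i) :: dag p).
  by rewrite -catA !degE deg_dag; apply => /=; lia.
rewrite /LLsum /=.
have shiftE a : tail (fun k => F (dag [:: Ll (s - k); Ll k])) a B = tail f (a - s) B.
  transitivity (tail (fun k => f (k + - s)) a B).
    apply: eq_tail => k _; rewrite /f /dag /rev /= /adj /=.
    by congr (F [:: (_, _); (_, _)]); lia.
  rewrite tail_shift (tail_widen _ f0); last by lia.
  by rewrite -(@tail_widen _ f _ (deg p) B) //; lia.
rewrite !shiftE -/f.
have f0B : vanishes_above B f by move=> k kB; apply: f0; lia.
have pairE j : f (- s - j) = f j + ((s == 0)%:R * (c / 12 * (j%:~R ^+ 3 - j%:~R) * F [::])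
   + (2 * j%:~R + s%:~R) * F [:: Ll (- s)]).
  rewrite /f (_ : - s - (- s - j) = j); last by lia.
  rewrite (@exchangeLL K c beta F (- deg p) _ exF [::] j (- s - j) [::]) /=; last by rewrite !wtE; lia.
  have -> : j + (- s - j) = - s by lia.
  by rewrite oppr_eq0; ring.
rewrite (tailS (-1) f0B) (tailS (-1 + 1) f0B) (tailS (-1 + 1 + 1) f0B).
rewrite (tailS (-1 - s) f0B) (tailS (-1 - s + 1) f0B) (tailS (-1 - s + 1 + 1) f0B).
have -> : -1 - s = - s - 1 by lia.
have -> : - s - 1 + 1 = - s - 0 by lia.
have -> : - s - 0 + 1 = - s - (-1) by lia.
have -> : - s - (-1) + 1 = - s + 2 by lia.
have -> : -1 + 1 + 1 + 1 = s + 2 - s by lia.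
rewrite !pairE (_ : -1 + 1 = 0) // add0r -[phi _]/(F [:: Ll (- s)]).
by field.
Qed.

Lemma bracket_dag p x y q :
  eval (fun t => phi (dag q ++ t ++ dag p)) (bracket c beta (adj y) (adj x) (- deg p)) =
  eval (fun t => phi (dag q ++ dag t ++ dag p)) (bracket c beta x y (deg q)).
Proof.
case: x y => [[] m] [[] n]; rewrite /adj !eval_bracketE /= -?(opprD n m) (addrC n m) ?oppr_eq0;
  rewrite ?Lambda_dag /dag /rev /= /adj /=.
all: have [s0|_] := eqVneq (m + n) 0; rewrite ?mul0r; try ring.
all: by rewrite (_ : n = - m); [ring | lia].
Qed.

(** Both sides satisfy the same relations and agree on sorted words, so they
    agree by straightening. *)
Lemma phi_dag u : phi (dag u) = phi u.
Proof.
elim/word_ind: u => [u u_sorted|p x y q yx IHswap IHbr].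
  have [zu|/(sorted_nonzero_mode u_sorted)[p [q [-> pq]]]] := boolP (all zero_mode u).
    have dag_u : map adj u = u.
      elim: u zu {u_sorted} => //= -[b n] u IH /andP[/eqP /= -> /IH ->].
      by rewrite /adj /= oppr0.
    by rewrite /dag dag_u !phi_zero_modes ?all_rev // big_rev.
  rewrite dag_cat; case: pq => [q0|p0].
    by rewrite phi_vanish_left ?phi_vanish // deg_dag; lia.
  by rewrite phi_vanish ?phi_vanish_left // deg_dag; lia.
rewrite dag_cat !dag_cons !cat_rcons phi_exchange (phi_exchange p) -IHswap.
rewrite dag_cat !dag_cons !cat_rcons deg_dag bracket_dag; congr (_ + _).
apply: eval_congr => t tin; rewrite -(IHbr _ _ tin).
by rewrite !dag_cat catA.
Qed.

Lemma bracket_fixed (sigma : {rmorphism K -> K}) x y d t :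
  sigma c = c -> sigma beta = beta -> t \in bracket c beta x y d -> sigma t.1 = t.1.
Proof.
move=> sc sb; pose ok := [pred t : K * word | sigma t.1 == t.1].
suff /allP fixed : all ok (bracket c beta x y d) by move=> /fixed /eqP.
have fixE := (rmorphM, rmorphN, fmorphV, rmorph1, rmorph_nat, rmorph_int, sc, sb).
have centralP a s : sigma a = a -> all ok (central a s).
  by rewrite /central; case: eqP => //= _ ->; rewrite eqxx.
case: x y => [[] m] [[] n]; rewrite /bracket /= ?all_cat ?centralP /= ?fixE ?eqxx //.
rewrite !andbT; apply/allP => _ /mapP[q + ->]; rewrite mem_cat inE.
suff fixq : sigma q.1 = q.1 -> ok (beta * (m - n)%:~R * q.1, q.2).
  by case/orP => [/mapP[k _ qE]|/eqP qE]; apply: fixq; rewrite qE /= ?fixE.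
by move=> sq; rewrite /ok /= !fixE sq.
Qed.

(** For the conjugation this says that [phi] is real if [c], [h], [w] and [b^2]
    are. *)
Lemma phi_fixed (sigma : {rmorphism K -> K}) u :
  sigma c = c -> sigma h = h -> sigma w = w -> sigma beta = beta -> sigma (phi u) = phi u.
Proof.
move=> sc sh sw sb; elim/word_ind: u => [u u_sorted|p x y q yx IHswap IHbr].
  rewrite phi_sorted // rmorph_prod; apply: eq_bigr => x _.
  by rewrite /weight_of; case: eqP; rewrite ?rmorph0 //; case: ifP.
rewrite phi_exchange rmorphD IHswap; congr (_ + _).
rewrite /eval rmorph_sum big_seq [RHS]big_seq; apply: eq_bigr => t tin.
by rewrite rmorphM (bracket_fixed sc sb tin) (IHbr _ _ tin).
Qed.
End State.

(** * The representation spanned by the functional *)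

Lemma mem_int_range a B k : (k \in int_range a B) = (a <= k <= B).
Proof.
apply/mapP/andP => [[i + ->]|[ak kB]].
  by rewrite mem_iota /=; case: ifP => // ?; lia.
exists `|k - a|%N; last by lia.
by rewrite mem_iota /=; case: ifP; lia.
Qed.

Lemma int_range_uniq a B : uniq (int_range a B).
Proof. by rewrite map_inj_uniq ?iota_uniq // => i j; lia. Qed.

(** Relates the sums of finite support in the definition of [Lambda] to sums
    over an explicit list. *)
Lemma fsbig_eq_seq (V : nmodType) (r : seq int) (P : set int) (f : int -> V) :
  uniq r -> (forall k, k \in r -> P k) -> (forall k, P k -> k \notin r -> f k = 0) ->
  \sum_(k \in P) f k = \sum_(k <- r) f k.
Proof.
move=> r_uniq rP f0; rewrite [RHS]fsbig_seq //; symmetry.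
apply: fsbig_widen => [k /rP //|k [Pk /negP rk]]; exact: f0.
Qed.

Section GNS.
Variables (R : realType) (c h w beta : R[i]).
Hypothesis beta_c : beta * (22 + 5 * c) = 16.
Local Notation K := (R[i]).
Local Notation phi := (phi c h w beta).

(** The vector [sum_i a_i u_i Psi], for a combination of words [u_i], as the
    function that maps [b] to the component of [b sum_i a_i u_i Psi] along the
    lowest weight vector [Psi]. *)
Definition vector (s : comb K) : word -> K := fun b => eval (fun a => phi (b ++ a)) s.

Definition spanned : {pred (word -> K)} := fun g => `[< exists s, g = vector s >].

Lemma spannedP g : reflect (exists s, g = vector s) (g \in spanned).
Proof. exact: asboolP. Qed.

Lemma spanned_submod : submod_closed spanned.
Proof.
split; first by apply/spannedP; exists [::]; apply/funext => b; rewrite /vector /eval big_nil.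
move=> a _ _ /spannedP[s ->] /spannedP[t ->]; apply/spannedP; exists (scale a s ++ t).
by apply/funext => b; rewrite /vector eval_cat eval_scale.
Qed.

HB.instance Definition _ := GRing.isSubmodClosed.Build K (word -> K) spanned spanned_submod.

Record gns := Gns { gns_fun : word -> K; gns_spanned : gns_fun \in spanned }.

HB.instance Definition _ := [isSub for gns_fun].
HB.instance Definition _ := [Choice of gns by <:].
HB.instance Definition _ := [SubChoice_isSubZmodule of gns by <:].
HB.instance Definition _ := [SubZmodule_isSubLmodule of gns by <:].

Definition coef (v : gns) (b : word) : K := gns_fun v b.

Lemma gnsP (u v : gns) : (forall b, coef u b = coef v b) -> u = v.
Proof. by move=> uv; apply: val_inj; apply/funext. Qed.

Lemma coef0 b : coef 0 b = 0. Proof. by []. Qed.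
Lemma coefD u v b : coef (u + v) b = coef u b + coef v b. Proof. by []. Qed.
Lemma coefB u v b : coef (u - v) b = coef u b - coef v b. Proof. by []. Qed.
Lemma coefZ a u b : coef (a *: u) b = a * coef u b. Proof. by []. Qed.
Lemma coef_sum (I : Type) (r : seq I) (F : I -> gns) b :
  coef (\sum_(i <- r) F i) b = \sum_(i <- r) coef (F i) b.
Proof. by elim/big_rec2: _ => [|i x y _ <-]; rewrite ?coef0 ?coefD. Qed.
Definition coefE := (coefB, coefD, coefZ, coef0).

Lemma gns_vector (v : gns) : exists s, forall b, coef v b = vector s b.
Proof. by case: v => g gS; have /spannedP[s gE] := gS; exists s => b; rewrite /coef /= gE. Qed.

Lemma mode_spanned (x : letter) (v : gns) : (fun b => coef v (rcons b x)) \in spanned.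
Proof.
have [s vE] := gns_vector v; apply/spannedP; exists [seq (q.1, x :: q.2) | q <- s].
by apply/funext => b; rewrite vE /vector /eval big_map; apply: eq_bigr => q _; rewrite cat_rcons.
Qed.

(** A letter acts on the left of the words [u_i], i.e. at the right end of the
    argument [b]. *)
Definition mode (x : letter) (v : gns) : gns := Gns (mode_spanned x v).

Lemma coef_mode x v b : coef (mode x v) b = coef v (rcons b x).
Proof. by []. Qed.

Lemma mode_linear x : linear (mode x).
Proof. by move=> a u v; apply: gnsP => b; rewrite coef_mode !coefE !coef_mode. Qed.

HB.instance Definition _ x := GRing.isLinear.Build K gns gns *:%R (mode x) (mode_linear x).

Definition gnsL (n : int) : {linear gns -> gns} := mode (Ll n).
Definition gnsW (n : int) : {linear gns -> gns} := mode (Wl n).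

Lemma word_state_spanned a : (fun b => phi (b ++ a)) \in spanned.
Proof.
apply/spannedP; exists [:: (1, a)].
by apply/funext => b; rewrite /vector eval1 mul1r.
Qed.

Definition word_state (a : word) : gns := Gns (word_state_spanned a).

Lemma mode_word_state x a : mode x (word_state a) = word_state (x :: a).
Proof. by apply: gnsP => b; rewrite /coef /= /coef /= cat_rcons. Qed.

Lemma vector_word_state (v : gns) s : (forall b, coef v b = vector s b) ->
  v = \sum_(q <- s) q.1 *: word_state q.2.
Proof. by move=> vE; apply: gnsP => b; rewrite vE coef_sum. Qed.

Lemma deg_lower_bound (s : comb K) : exists d, forall q, q \in s -> d <= deg q.2.
Proof.
elim: s => [|p s [d dP]]; first by exists 0.
exists (Num.min d (deg p.2)) => q; rewrite inE ge_min => /orP[/eqP ->|/dP ->] //.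
by rewrite lexx orbT.
Qed.

Lemma bracket_widen (F : word -> K) x y (d d' : int) :
  (forall i j, 0 < j + d' -> F [:: Ll i; Ll j] = 0) -> d <= d' ->
  eval F (bracket c beta x y d) = eval F (bracket c beta x y d').
Proof.
move=> F0 dd'; case: x y => [[] m] [[] n]; rewrite !eval_bracketE // !eval_Lambda.
by rewrite (@LLsum_widen _ F (m + n) d' (- d) F0) //; lia.
Qed.

(** A combination of finitely many words has a lower bound [d] for their
    degrees.  It bounds the modes that do not kill the vector, and truncating
    [Lambda] according to [d] is correct for all the words at once. *)
Lemma gns_bounded (v : gns) : exists d : int,
  (forall b t, 0 < deg t + d -> coef v (b ++ t) = 0) /\
  forall b x y, coef v (b ++ [:: x; y]) = coef v (b ++ [:: y; x])
    + eval (fun t => coef v (b ++ t)) (bracket c beta x y d).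
Proof.
have [s vE] := gns_vector v; have [d dP] := deg_lower_bound s; exists d; split=> [b t td|b x y].
  rewrite vE /vector /eval big_seq big1 // => q /dP qd.
  rewrite -catA (phi_vanish h w beta_c) ?mulr0 // degE.
  by apply: lt_le_trans td _; rewrite lerD2l.
transitivity (coef v (b ++ [:: y; x]) +
    eval (fun t => eval (fun a => phi (b ++ t ++ a)) s) (bracket c beta x y d)); last first.
  by congr (_ + _); apply: eval_congr => t _; rewrite vE; apply: eval_congr => a _; rewrite catA.
rewrite eval_exchange !vE -big_split /vector /eval /= big_seq [RHS]big_seq.
apply: eq_bigr => q qs; rewrite -mulrDr -!catA /= (phi_exchange h w beta_c); congr (_ * (_ + _)).
apply/esym/bracket_widen; last exact: dP.
move=> i j ij; have := @phi_vanish _ c h w _ beta_c (b ++ [:: Ll i]) (Ll j :: q.2).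
by rewrite -catA; apply; rewrite degE.
Qed.

Lemma gns_field (b : bool) (a : int) : is_field (fun n => mode (b, n - a)).
Proof.
move=> v; have [d [v0 _]] := gns_bounded v; exists (1 + a - d) => n nd.
apply: gnsP => u; rewrite coef_mode -cats1 v0 ?coef0 //.
by rewrite degE deg_nil /=; lia.
Qed.

(** The sum over [k <= -2] is reindexed by [k -> s - k]; beyond the truncation
    the rightmost mode of each product kills the vector. *)
Lemma coef_Lambda v d s b : (forall b t, 0 < deg t + d -> coef v (b ++ t) = 0) ->
  coef (Lambda gnsL s v) b = eval (fun t => coef v (b ++ t)) (Lambda_comb K s d).
Proof.
move=> v0; rewrite eval_Lambda /Lambda coefB coefD coefZ coef_mode -cats1.
have v0' k : - d < k -> gnsL k v = 0.
  move=> kd; apply: gnsP => u; rewrite coef_mode -cats1 v0 ?coef0 //.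
  by rewrite degE deg_nil /=; lia.
congr (_ + _ - _).
  rewrite (@fsbig_eq_seq _ (int_range (-1) (- d))); first last.
  - move=> k /= k2; rewrite mem_int_range => kd; rewrite v0' ?linear0 //; lia.
  - by move=> k; rewrite mem_int_range /=; lia.
  - exact: int_range_uniq.
  by rewrite coef_sum; apply: eq_bigr => k _; rewrite !coef_mode -!cats1 -catA.
rewrite (@fsbig_eq_seq _ [seq s - k | k <- int_range (s + 2) (- d)]); first last.
- move=> k /= k2 kd; rewrite v0' ?linear0 // ltNge; apply/negP => skd.
  move/negP: kd; apply; apply/mapP; exists (s - k); last by lia.
  by rewrite mem_int_range; lia.
- by move=> _ /mapP[k + ->]; rewrite mem_int_range /=; lia.
- by rewrite map_inj_uniq ?int_range_uniq // => i j; lia.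
rewrite coef_sum big_map; apply: eq_bigr => k _.
rewrite (_ : s - (s - k) = k); last by lia.
by rewrite !coef_mode -!cats1 -catA.
Qed.

Lemma gns_W3_representation : beta = b2 c -> W3_representation c gnsL gnsW.
Proof.
move=> betaE; split; try exact: gns_field.
- move=> m n v; apply: gnsP => b; have [d [_ ex]] := gns_bounded v.
  rewrite !coefE !coef_mode -!cats1 -!catA /= ex eval_bracketE /= ?cats0; ring.
- move=> m n v; apply: gnsP => b; have [d [_ ex]] := gns_bounded v.
  rewrite !coefE !coef_mode -!cats1 -!catA /= ex eval_bracketE /=; ring.
- move=> m n v; apply: gnsP => b; have [d [v0 ex]] := gns_bounded v.
  move: (Lambda _ _ v) (coef_Lambda (m + n) b v0) => X XE.
  rewrite !coefE XE !coef_mode -!cats1 -!catA /= ex eval_bracketE /= -betaE.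
  by rewrite (_ : 5`! = 120%N) // cats0; field.
Qed.

Lemma gns_lowest_weight_vector : lowest_weight_vector gnsL gnsW h w (word_state [::]).
Proof.
split.
- apply/eqP => /(congr1 (coef^~ [::])) /eqP.
  by rewrite /coef /= phi_nil oner_eq0.
- move=> n n0; split; apply: gnsP => b;
    by rewrite coef_mode -cats1 /coef /= cats0 (phi_vanish h w beta_c) // degE deg_nil addr0.
- by apply: gnsP => b; rewrite coef_mode coefZ /coef /= !cats0 (phi_eigen _ _ beta_c).
- by apply: gnsP => b; rewrite coef_mode coefZ /coef /= !cats0 (phi_eigen _ _ beta_c).
Qed.

Lemma gns_cyclic : cyclic gnsL gnsW (word_state [::]).
Proof.
rewrite /cyclic; apply/seteqP; split=> // v _ M [[[M0 Mlin] Minv] MPsi].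
have Mword a : M (word_state a).
  elim: a => [|[[] n] a IH]; first exact: MPsi.
    by rewrite -mode_word_state; case: (Minv n _ IH).
  by rewrite -mode_word_state; case: (Minv n _ IH).
have [s /vector_word_state ->] := gns_vector v.
elim: s => [|q s IH]; first by rewrite big_nil; move: M0; rewrite inE.
by rewrite big_cons; have := Mlin q.1 (word_state q.2) (\sum_(q <- s) q.1 *: word_state q.2);
  rewrite !inE; apply.
Qed.

Lemma gns_lowest_weight_representation : beta = b2 c ->
  lowest_weight_representation c h w gnsL gnsW.
Proof.
move=> betaE; split; first exact: gns_W3_representation.
by exists (word_state [::]); split; [exact: gns_lowest_weight_vector | exact: gns_cyclic].
Qed.

Section Form.
Variable theta : {rmorphism K -> K}.
Hypotheses (thetaK : involutive theta) (theta_phi : forall u, theta (phi u) = phi u).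

Definition representative (v : gns) : comb K := xget [::] [set s | forall b, coef v b = vector s b]%classic.

Lemma representativeP v b : coef v b = vector (representative v) b.
Proof. by have [s vE] := gns_vector v; rewrite /representative; case: xgetP => [_ _ -> //|/(_ s)]. Qed.

(** The pairing of [x] with the combination [s], semilinear in [s] with respect
    to [theta], which is the identity or the complex conjugation. *)
Definition form_on (x : gns) (s : comb K) : K := \sum_(q <- s) theta q.1 * coef x (dag q.2).

Definition gns_form (x y : gns) : K := form_on x (representative y).

(** Expressing [x] as a combination too, the double sum is Hermitian since
    [phi (dag u ++ v) = phi (dag v ++ u)].  The right-hand side depends on [y]
    only through the values of [y], so the pairing does not depend on the
    combination representing [y]. *)
Lemma form_onE x y r s : (forall b, coef x b = vector r b) -> (forall b, coef y b = vector s b) ->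
  form_on x s = theta (form_on y r).
Proof.
move=> xE yE; rewrite {2}/form_on rmorph_sum.
transitivity (\sum_(q <- s) \sum_(p <- r) theta q.1 * (p.1 * phi (dag q.2 ++ p.2))).
  by apply: eq_bigr => q _; rewrite xE /vector /eval mulr_sumr.
rewrite exchange_big; apply: eq_bigr => p _ /=.
rewrite rmorphM thetaK yE /vector /eval rmorph_sum mulr_sumr; apply: eq_bigr => q _.
rewrite rmorphM theta_phi mulrCA -(phi_dag h w beta_c (dag q.2 ++ p.2)).
by rewrite dag_cat dagK.
Qed.

Lemma gns_formE x y s : (forall b, coef y b = vector s b) -> gns_form x y = form_on x s.
Proof.
move=> yE; rewrite /gns_form (form_onE (representativeP x) (representativeP y)).
by rewrite (form_onE (representativeP x) yE).
Qed.

Lemma gns_form_hermitian x y : gns_form x y = theta (gns_form y x).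
Proof. exact: form_onE (representativeP x) (representativeP y). Qed.

Lemma gns_form_linearl y : GRing.linear_for *%R (gns_form^~ y).
Proof.
move=> a u v; rewrite /gns_form /form_on mulr_sumr -big_split.
by apply: eq_bigr => q _; rewrite coefD coefZ mulrDr mulrCA.
Qed.

Lemma gns_form_linearr x : GRing.linear_for (theta \; *%R) (gns_form x).
Proof.
move=> a u v; rewrite !(gns_form_hermitian x) gns_form_linearl rmorphD rmorphM.
by [].
Qed.

HB.instance Definition _ := bilinear_isBilinear.Build K gns gns K *%R (theta \; *%R) gns_form
  (gns_form_linearl, gns_form_linearr).

Lemma gns_form_hermitian_subproof x y : gns_form x y = (-1) ^+ false * theta (gns_form y x).
Proof. by rewrite mul1r; exact: gns_form_hermitian. Qed.

HB.instance Definition _ := isHermitianSesquilinear.Build K gns false theta gns_form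
  gns_form_hermitian_subproof.

Definition gns_hermitian : {hermitian_sym gns for theta} := gns_form.

Lemma adjK : involutive adj.
Proof. by case=> b n; rewrite /adj /= opprK. Qed.

Lemma gns_form_mode l x y : gns_form (mode l x) y = gns_form x (mode (adj l) y).
Proof.
rewrite (@gns_formE x _ [seq (q.1, adj l :: q.2) | q <- representative y]) => [|b].
  by rewrite /gns_form /form_on big_map; apply: eq_bigr => q _; rewrite dag_cons adjK.
rewrite coef_mode representativeP /vector /eval big_map.
by apply: eq_bigr => q _; rewrite cat_rcons.
Qed.

Lemma gns_form_invariant : invariant_form gnsL gnsW gns_form.
Proof. by move=> n x y; rewrite !gns_form_mode. Qed.

(** The pairing with the word [dag b] is the value at [b]. *)
Lemma gns_form_nondegenerate : nondegenerate_form gns_form.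
Proof.
move=> x x0; apply: gnsP => b; rewrite coef0 -(x0 (word_state (dag b))).
rewrite (@gns_formE x _ [:: (1, dag b)]) => [|b'].
  by rewrite /form_on big_seq1 rmorph1 mul1r dagK.
by rewrite /vector eval1 mul1r.
Qed.

Lemma gns_hermitian_form : exists f : {hermitian_sym gns for theta},
  invariant_form gnsL gnsW f /\ nondegenerate_form f.
Proof. by exists gns_hermitian; split; [exact: gns_form_invariant | exact: gns_form_nondegenerate]. Qed.
End Form.
End GNS.

Unset Implicit Arguments.

Theorem corollaryA2 (R : realType) (c h w : R[i]) (hc : c != - (22 / 5)) :
  (exists (V : lmodType R[i]) (L W : int -> {linear V -> V}),
      lowest_weight_representation c h w L W /\
      exists f : {symmetric V},
        invariant_form L W f /\ nondegenerate_form f)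
  /\
  (c \is Num.real -> h \is Num.real -> w \is Num.real ->
   exists (V : lmodType R[i]) (L W : int -> {linear V -> V}),
      lowest_weight_representation c h w L W /\
      exists f : {hermitian_sym V for @Num.conj R[i]},
        invariant_form L W f /\ nondegenerate_form f).
Proof.
have c0 : 22 + 5 * c != 0.
  apply: contra_neq hc => c0; apply: (mulfI (x := 5)); first by rewrite pnatr_eq0.
  by rewrite -(addKr 22 (5 * c)) c0 addr0; field.
have beta_c : b2 c * (22 + 5 * c) = 16 by rewrite /b2 divfK.
split=> [|cR hR wR]; exists (gns c h w (b2 c)), (gnsL _ _ _ _), (gnsW _ _ _ _);
  (split; first exact: gns_lowest_weight_representation).
- exact: (gns_hermitian_form beta_c (theta := idfun)).
- apply: (gns_hermitian_form beta_c (theta := Num.conj)); first exact: conjCK.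
  move=> u; have fixedC x : x \is Num.real -> x^* = x by move/CrealP.
  have bR : b2 c \is Num.real.
    by rewrite /b2 realM ?realV ?realn // realD ?realn // realM ?realn.
  apply: phi_fixed; rewrite ?beta_c //; exact: fixedC.
Qed.
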